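(* Let $g,n\ge 0$ be integers with $2g-2+n>0$. The extended generalized cone complex $\overline{S}_{g,n}^{\mathrm{trop}}$ has pure dimension $3g-3+n$ and has two connected components, corresponding to the parity of the spin structure. There is a natural map $\pi^{\mathrm{trop}}\colon \overline{S}_{g,n}^{\mathrm{trop}}\to \overline{M}^{\mathrm{trop}}_{g,n}$ (described in the context) which is a morphism of extended generalized cone complexes, and for every stable $n$-pointed extended tropical curve $\Gamma$ of genus $g$ we have $(\pi^{\mathrm{trop}})^{-1}([\Gamma])\cong S_{\Gamma}^{\mathrm{trop}}/\mathrm{Aut}(\Gamma)$.
   Context: **Graphs.** A graph $G=(V,E,L,w)$ consists of a nonempty finite vertex set $V=V(G)$ with a weight function $w\colon V\to\mathbb{Z}_{\ge0}$, a finite set of half-edges with an involution and an endpoint map to $V$; the set of edges $E=E(G)$ consists of the two-element orbits of the involution, and the (ordered) set of legs $L$ of its fixed points; $n=|L|$. For $v\in V$, $\deg(v)$ is the number of half-edges other than legs at $v$ and $\mathrm{leg}(v)$ the number of legs at $v$. $b_1(G)=|E|-|V|+c(G)$, with $c(G)$ the number of connected components, and the genus is $g(G)=b_1(G)+\sum_v w(v)$. $G$ is stable if it is connected and $2w(v)-2+\deg(v)+\mathrm{leg}(v)>0$ for all $v$. Isomorphisms are bijections on vertices and half-edges compatible with the structure, preserving weights and the order of the legs. For $F\subset E$, the contraction $\gamma\colon G\to G/F$ contracts all edges in $F$; $G/F$ has the same legs as $G$, $E(G/F)=E\smallsetminus F$, and the weight of a vertex $v$ of $G/F$ is $g(\gamma^{-1}(v))$.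 $\mathcal{G}_{g,n}$ is the finite set of isomorphism classes of stable graphs of genus $g$ with $n$ legs. **Spin graphs.** A subset $P\subset E$ is cyclic if every vertex has even degree in the subgraph spanned by $P$ (loops count twice). A spin graph is a triple $(G,P,s)$ with $P\subset E$ cyclic and $s\colon V(G/P)\to\mathbb{Z}/2\mathbb{Z}$ a function with $s(v)=0$ whenever $v$ has weight $0$ in $G/P$. The pair $(P,s)$ is a spin structure on $G$; $SP_G$ is the set of spin structures on $G$. The parity of $(G,P,s)$ is that of $\sum_v s(v)$. A contraction $\gamma\colon G\to G'=G/F$ induces $\gamma_*\colon SP_G\to SP_{G'}$, $(P,s)\mapsto(P',s')$, with $P'=P\smallsetminus F$ and $s'(v')=\sum_{v\in\overline\gamma^{-1}(v')}s(v)$, where $\overline\gamma\colon G/P\to G'/P'=G/(F\cup P)$ is the induced contraction. Isomorphisms act on spin structures similarly. Contractions/isomorphisms of spin graphs are those of graphs mapping the given spin structure to the given one. **Tropical curves.** An ($n$-pointed) extended tropical curve is $\Gamma=(G,\ell)$ with $G$ a graph with $n$ legs and $\ell\colon E\to\mathbb{R}_{>0}\cup\{\infty\}$; it is stable if $G$ is, and its genus is that of $G$. $\mathrm{Aut}(\Gamma)$ is the group of automorphisms of $G$ preserving $\ell$. An extended spin tropical curve is $\Psi=(\Gamma,P,s)$ with $\Gamma=(G,\ell)$ and $(P,s)\in SP_G$; its parity is the parity of $(P,s)$. Isomorphisms are isomorphisms of tropical curves carrying the spin structures into each other. $S_\Gamma^{\mathrm{trop}}=\{(\Gamma,P,s):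 (P,s)\in SP_G\}$, on which $\mathrm{Aut}(\Gamma)$ acts. **Moduli spaces.** $\overline{\mathbb{R}}_{\ge0}=\mathbb{R}_{\ge0}\cup\{\infty\}$. An extended generalized cone complex is a colimit of a finite diagram of extended rational polyhedral cones with integral structure, whose arrows are face morphisms (isomorphisms onto faces, including automorphisms); a morphism of such is a continuous map such that the restriction to each cone of the source factors through an integral linear map to a cone of the target. $\overline{M}_{g,n}^{\mathrm{trop}}$ (moduli space of stable extended $n$-pointed tropical curves of genus $g$) is the colimit of the extended cones $\overline\sigma_G=\overline{\mathbb{R}}_{\ge0}^{E(G)}$, $G\in\mathcal{G}_{g,n}$, along the maps induced by contractions and automorphisms. $\overline{S}_{g,n}^{\mathrm{trop}}$ (moduli space of stable extended $n$-pointed spin tropical curves of genus $g$) is the colimit of the extended cones $\overline\sigma_{(G,P,s)}=\overline{\mathbb{R}}_{\ge0}^{E(G)}$, over isomorphism classes of stable spin graphs of genus $g$ with $n$ legs, where a contraction $(G,P,s)\to(G',P',s')$ gives the inclusion of $\overline\sigma_{(G',P',s')}$ as the face of $\overline\sigma_{(G,P,s)}$ where the coordinates in $E(G)\smallsetminus E(G')$ vanish, and automorphisms of spin graphs act by permuting coordinates. Points of the two colimits correspond to isomorphism classes of stable extended (spin) tropical curves. The map $\pi^{\mathrm{trop}}$ sends the class of $(\Gamma,P,s)$, $\Gamma=(G,\ell)$, to the class of $(G,\pi^{\mathrm{trop}}(\ell))$ where $\pi^{\mathrm{trop}}(\ell)(e)=2\ell(e)$ if $e\in E\smallsetminus P$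 and $\pi^{\mathrm{trop}}(\ell)(e)=\ell(e)$ if $e\in P$ (with $2\cdot\infty=\infty$).
   Formalization: The claim of two connected components fails for g=0, where every spin structure is even; the formal theorem states two components (even and odd) for g>0, and for g=0 a single even component with empty odd locus. *)

(* Defs.v *)
From HB Require Import structures.
From Stdlib Require Import Relation_Operators.
From mathcomp Require Import all_boot all_order all_algebra.
From mathcomp Require Import all_classical all_reals all_analysis.

Set Implicit Arguments.
Unset Strict Implicit.
Unset Printing Implicit Defensive.

Import Order.TTheory GRing.Theory Num.Theory.

Local Open Scope ring_scope.

(** ** Graphs *)

Record graph (V H : finType) (n : nat) := Graph {
  wt : V -> nat;
  endpt : H -> V;
  invol : H -> H;
  leg : 'I_n -> H;
  graph_vertex : (0 < #|V|)%N;
  involK : involutive invol;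
  leg_inj : injective leg;
  legP : forall h, invol h = h <-> exists i, h = leg i }.

Section Graph.
Context {V H : finType} {n : nat} (G : graph V H n).

Definition is_edge (e : {set H}) : bool :=
  [exists h, (invol G h != h) && (e == [set h; invol G h])].

Definition edge : finType := {e : {set H} | is_edge e}.

Implicit Types (A F : {set edge}) (U : {set V}).

Definition halves F : {set H} := (\bigcup_(e in F) val e).

Definition adj F : rel V := fun u v =>
  [exists h in halves F, (endpt G h == u) && (endpt G (invol G h) == v)].

Definition component F (v : V) : {set V} := [set u | connect (adj F) v u].

Definition comps F U : {set {set V}} := [set component F v | v in U].

(* First Betti number and genus of the subgraph (U, A), where the edges in A
   have their ends in U. The subtraction is on nat; it never truncates, since
   |U| <= |A| + c for every finite graph. *)
Definition betti1 A U : nat := (#|A| + #|comps A U| - #|U|)%N.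

Definition subgenus A U : nat := (betti1 A U + \sum_(v in U) wt G v)%N.

Definition genus : nat := subgenus [set: _] [set: _].

(* Both half-edges of a loop at v contribute, so loops count twice. *)
Definition deg (v : V) : nat :=
  #|[set h | (endpt G h == v) && (invol G h != h)]|.

Definition legs (v : V) : nat := #|[set i | endpt G (leg G i) == v]|.

Definition connected_graph : Prop := #|comps [set: _] [set: _]| = 1%N.

Definition stable : Prop :=
  connected_graph /\ forall v, (2 < 2 * wt G v + deg v + legs v)%N.

Definition cyclic F : Prop :=
  forall v, ~~ odd #|[set h in halves F | endpt G h == v]|.

(** ** Contractions *)

Section Contraction.
Variable F : {set edge}.

(* The vertices of G/F are the connected components of (V, F). *)
Definition cvertex : finType := {C : {set V} | C \in comps F [set: _]}.

Definition cproj (v : V) : cvertex :=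
  exist _ (component F v) (imset_f (component F) (finset.in_setT v)).

Definition chalf : finType := {h : H | h \notin halves F}.

Lemma inv_halves h : (invol G h \in halves F) = (h \in halves F).
Proof.
suff sub x : x \in halves F -> invol G x \in halves F.
  by apply/idP/idP => [/sub|/sub//]; rewrite involK.
move=> /finset.bigcupP[e eF xe]; apply/finset.bigcupP; exists e => //.
move: (valP e) xe => /existsP[h0 /andP[_ /eqP->]]; rewrite !finset.inE.
by move=> /orP[] /eqP->; rewrite ?involK eqxx ?orbT.
Qed.

Lemma leg_halves i : leg G i \notin halves F.
Proof.
apply/negP => /finset.bigcupP[e _]; have fixl : invol G (leg G i) = leg G i.
  by apply/legP; exists i.
move: (valP e) => /existsP[h /andP[hN /eqP->]]; rewrite !finset.inE.
move=> /orP[] /eqP E; move: hN; first by rewrite -E fixl eqxx.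
by rewrite -{1}E -fixl E involK eqxx.
Qed.

Definition cendpt (h : chalf) : cvertex := cproj (endpt G (val h)).

Definition cinv (h : chalf) : chalf :=
  exist _ (invol G (val h))
    (eq_ind_r (fun b => ~~ b) (valP h) (inv_halves (val h))).

Definition cleg (i : 'I_n) : chalf := exist _ (leg G i) (leg_halves i).

Definition cwt (C : cvertex) : nat :=
  subgenus [set e in F | [forall h in val e, endpt G h \in val C]] (val C).

Lemma cvertex_gt0 : (0 < #|cvertex|)%N.
Proof.
by case/card_gt0P: (graph_vertex G) => v _; apply/card_gt0P; exists (cproj v).
Qed.

Lemma cinvK : involutive cinv.
Proof. by move=> h; apply: val_inj; rewrite /= involK. Qed.

Lemma cleg_inj : injective cleg.
Proof. by move=> i j /(congr1 val)/= /leg_inj. Qed.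

Lemma clegP h : cinv h = h <-> exists i, h = cleg i.
Proof.
split=> [/(congr1 val)/= /legP[i hi]|[i ->]]; first by exists i; apply: val_inj.
by apply: val_inj => /=; apply/legP; exists i.
Qed.

Definition contraction : graph cvertex chalf n :=
  Graph cwt cendpt cvertex_gt0 cinvK cleg_inj clegP.

End Contraction.
End Graph.

Arguments edge {V H n} G.

(* The identification of E(G/F) with the subset E \ F of E. *)
Lemma uncontract_subproof (V H : finType) (n : nat) (G : graph V H n)
    (F : {set edge G}) (e : edge (contraction F)) :
  is_edge G (val @: val e).
Proof.
case: e => e /= /existsP[h /andP[hN /eqP->]]; apply/existsP; exists (val h).
by rewrite -[invol G _]/(val (cinv h)) val_eqE hN imsetU1 imset_set1 eqxx.
Qed.

Definition uncontract (V H : finType) (n : nat) (G : graph V H n)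
    (F : {set edge G}) (e : edge (contraction F)) : edge G :=
  exist (fun x => is_edge G x) _ (uncontract_subproof e).

(** ** Isomorphisms *)

Record iso (V H V' H' : finType) (n : nat)
    (G : graph V H n) (G' : graph V' H' n) := Iso {
  isoV : V -> V';
  isoH : H -> H';
  isoV_bij : bijective isoV;
  isoH_bij : bijective isoH;
  iso_endpt : forall h, endpt G' (isoH h) = isoV (endpt G h);
  iso_inv : forall h, invol G' (isoH h) = isoH (invol G h);
  iso_wt : forall v, wt G' (isoV v) = wt G v;
  iso_leg : forall i, leg G' i = isoH (leg G i) }.

Lemma iso_edge_subproof (V H V' H' : finType) (n : nat)
    (G : graph V H n) (G' : graph V' H' n) (a : iso G G') (e : edge G) :
  is_edge G' (isoH a @: val e).
Proof.
case: e => e /= /existsP[h /andP[hN /eqP->]]; apply/existsP; exists (isoH a h).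
by rewrite iso_inv (inj_eq (bij_inj (isoH_bij a))) hN imsetU1 imset_set1 eqxx.
Qed.

Definition iso_edge (V H V' H' : finType) (n : nat)
    (G : graph V H n) (G' : graph V' H' n) (a : iso G G') (e : edge G) :
  edge G' := exist (fun x => is_edge G' x) _ (iso_edge_subproof a e).

(** ** Spin structures *)

Record spin (V H : finType) (n : nat) (G : graph V H n) := Spin {
  cyc : {set edge G};
  sgn : cvertex cyc -> 'Z_2;
  cycP : cyclic cyc;
  sgnP : forall C, wt (contraction cyc) C = 0%N -> sgn C = 0 }.

Arguments sgn {V H n G} s C.

Definition parity (V H : finType) (n : nat) (G : graph V H n) (S : spin G) :
  'Z_2 := \sum_C sgn S C.

(* S' is the direct image of S under the contraction of F. For C a vertex of
   G/P and v any vertex of G in C, the image of C in (G/F)/P' is the vertex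
   of (G/F)/P' containing the image of v in G/F. *)
Definition spin_contract (V H : finType) (n : nat) (G : graph V H n)
    (F : {set edge G}) (S : spin G) (S' : spin (contraction F)) : Prop :=
  cyc S' = [set e | uncontract e \in cyc S] /\
  forall C', sgn S' C' =
    \sum_(C : cvertex (cyc S) |
        [exists v in val C, cproj (cyc S') (cproj F v) == C']) sgn S C.

(* The isomorphism a carries S to S'. The induced bijection from the vertices
   of G/P to those of G'/P' sends the class of v to the class of a(v). *)
Definition spin_iso (V H V' H' : finType) (n : nat)
    (G : graph V H n) (G' : graph V' H' n) (a : iso G G')
    (S : spin G) (S' : spin G') : Prop :=
  cyc S' = (iso_edge a @: cyc S) /\
  forall v, sgn S' (cproj (cyc S') (isoV a v)) = sgn S (cproj (cyc S) v).

(** ** Extended generalized cone complexes *)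

Local Open Scope classical_set_scope.

(* The cones occurring here are the extended cones \bar R_{>=0}^I with the
   integral structure Z^I, I a finite set, so only these are considered. *)
Definition orthant (R : realType) (I : finType) : set {ptws I -> \bar R} :=
  [set x | forall i, (0 <= x i)%E].

Definition cone (R : realType) (I : finType) : topologicalType :=
  set_type (@orthant R I).

Definition coord (R : realType) (I : finType) (x : cone R I) (i : I) : \bar R :=
  set_val x i.

(* The entries of the matrix are forced to be nonnegative since f has values
   in an orthant; recall that 0 * +oo = 0 in \bar R. *)
Definition integral_linear (R : realType) (I J : finType)
    (f : cone R I -> cone R J) : Prop :=
  exists A : J -> I -> int, forall x j,
    coord (f x) j = (\sum_(i : I) ((A j i)%:~R)%:E * coord x i)%E.

Definition is_face (R : realType) (I : finType) (B : set (cone R I)) : Prop :=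
  exists K : {set I}, B = [set x | forall i, i \in K -> coord x i = 0%E].

Definition face_morphism (R : realType) (I J : finType)
    (f : cone R I -> cone R J) : Prop :=
  [/\ integral_linear f, is_face (range f) &
      exists2 f' : cone R J -> cone R I, integral_linear f' & cancel f f'].

Record cone_diagram (R : realType) := ConeDiagram {
  obj : choiceType;
  ray : obj -> finType;
  arr : forall a b : obj, (cone R (ray a) -> cone R (ray b)) -> Prop }.

(* There are only finitely many face morphisms between two given cones, so
   that finitely many objects make a finite diagram. *)
Definition extended_generalized_cone_complex (R : realType)
    (D : cone_diagram R) : Prop :=
  finite_set [set: obj D] /\
  forall (a b : obj D) f, @arr R D a b f -> face_morphism f.

Section Colimit.
Local Open Scope quotient_scope.
Context {R : realType} (D : cone_diagram R).

Definition cone_union : topologicalType := {a : obj D & cone R (ray a)}.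

Definition gluing (p q : cone_union) : Prop :=
  exists2 f, @arr R D (projT1 p) (projT1 q) f & f (projT2 p) = projT2 q.

Definition glued (p q : cone_union) : bool :=
  `[< clos_refl_sym_trans cone_union gluing p q >].

Lemma glued_equiv : equiv_class_of glued.
Proof.
split=> [p|p q|q p r].
- exact/asboolP/rst_refl.
- by apply/asboolP/asboolP => ?; apply: rst_sym.
- by move=> /asboolP pq /asboolP qr; apply/asboolP/(rst_trans _ _ _ _ _ pq qr).
Qed.

Definition glued_rel : equiv_rel cone_union := EquivRelPack glued_equiv.

Definition colim : topologicalType := quotient_topology {eq_quot glued_rel}.

Definition cone_pt (a : obj D) (x : cone R (ray a)) : colim :=
  \pi_{eq_quot glued_rel} (existT _ a x : cone_union).

(* A cone is maximal if it is not a proper face of another cone. *)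
Definition maximal_cone (a : obj D) : Prop :=
  forall (b : obj D) f, @arr R D a b f -> range f = setT.

Definition pure_dim (d : nat) : Prop :=
  forall a : obj D, maximal_cone a -> #|ray a| = d.

End Colimit.

Definition cone_complex_morphism (R : realType) (D D' : cone_diagram R)
    (phi : colim D -> colim D') : Prop :=
  continuous phi /\
  forall a : obj D, exists (b : obj D') (f : cone R (ray a) -> cone R (ray b)),
    integral_linear f /\ forall x, phi (cone_pt x) = cone_pt (f x).

Definition conn_components (T : topologicalType) : set (set T) :=
  range (connected_component [set: T]).

Arguments conn_components T : clear implicits.

(** ** Moduli spaces *)

(* Up to isomorphism the vertex set and the set of half-edges of a graph are
   'I_k and 'I_m. For fixed g and n there are finitely many such stable graphs,
   and the colimit over all of them, with all isomorphisms among the arrows, is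
   the colimit over isomorphism classes. *)
Record stable_graph (g n : nat) := StableGraph {
  nv : nat;
  nh : nat;
  sgraph :> graph 'I_nv 'I_nh n;
  sgraph_stable : stable sgraph;
  sgraph_genus : genus sgraph = g }.

HB.instance Definition _ g n := gen_eqMixin (stable_graph g n).
HB.instance Definition _ g n := gen_choiceMixin (stable_graph g n).

Record stable_spin_graph (g n : nat) := StableSpinGraph {
  spgraph : stable_graph g n;
  spspin : spin spgraph }.

HB.instance Definition _ g n := gen_eqMixin (stable_spin_graph g n).
HB.instance Definition _ g n := gen_choiceMixin (stable_spin_graph g n).

(* For a : G/F ~= G', f is the inclusion of the cone of G' as the face of the
   cone of G where the coordinates in F vanish. *)
Definition face_inclusion (R : realType) (V H V' H' : finType) (n : nat)
    (G : graph V H n) (F : {set edge G}) (G' : graph V' H' n)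
    (a : iso (contraction F) G')
    (f : cone R (edge G') -> cone R (edge G)) : Prop :=
  forall x, (forall e, e \in F -> coord (f x) e = 0%E) /\
    (forall e, coord (f x) (uncontract e) = coord x (iso_edge a e)).

Definition curve_complex (R : realType) (g n : nat) : cone_diagram R :=
  @ConeDiagram R (stable_graph g n) (fun G => edge G)
    (fun G' G f => exists (F : {set edge G}) (a : iso (contraction F) G'),
      face_inclusion a f).

Definition spin_complex (R : realType) (g n : nat) : cone_diagram R :=
  @ConeDiagram R (stable_spin_graph g n) (fun S => edge (spgraph S))
    (fun S' S f => exists (F : {set edge (spgraph S)})
        (a : iso (contraction F) (spgraph S')) (T : spin (contraction F)),
      [/\ spin_contract (spspin S) T, spin_iso a T (spspin S') &
          face_inclusion a f]).

Definition Mbar (R : realType) (g n : nat) : topologicalType :=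
  colim (curve_complex R g n).

Definition Sbar (R : realType) (g n : nat) : topologicalType :=
  colim (spin_complex R g n).

Definition parity_locus (R : realType) (g n : nat) (b : 'Z_2) :
    set (Sbar R g n) :=
  [set p | exists2 S : obj (spin_complex R g n), parity (spspin S) = b &
           exists x : cone R (ray S), p = cone_pt x].

Arguments parity_locus R g n b : clear implicits.

(** ** Tropical curves *)

Record curve (R : realType) (V H : finType) (n : nat) (G : graph V H n) :=
  Curve {
    len : edge G -> \bar R;
    len_gt0 : forall e, (0 < len e)%E }.

Lemma len_orthant (R : realType) (V H : finType) (n : nat) (G : graph V H n)
  (Gamma : curve R G) : len Gamma \in @orthant R (edge G).
Proof. by apply/mem_set => e; exact/ltW/len_gt0. Qed.

Definition curve_cone (R : realType) (V H : finType) (n : nat)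
    (G : graph V H n) (Gamma : curve R G) : cone R (edge G) :=
  exist _ (len Gamma : {ptws edge G -> \bar R}) (len_orthant Gamma).

Definition curve_class (R : realType) (g n : nat) (G : stable_graph g n)
    (Gamma : curve R G) : Mbar R g n :=
  @cone_pt R (curve_complex R g n) G (curve_cone Gamma).

Definition spin_curve_class (R : realType) (g n : nat) (G : stable_graph g n)
    (Gamma : curve R G) (S : spin G) : Sbar R g n :=
  @cone_pt R (spin_complex R g n) (StableSpinGraph S) (curve_cone Gamma).

Lemma pi_len_subproof (R : realType) (V H : finType) (n : nat)
    (G : graph V H n) (Gamma : curve R G) (S : spin G) (e : edge G) :
  (0 < if e \in cyc S then len Gamma e else 2%:E * len Gamma e)%E.
Proof. by case: ifP => _; rewrite ?mule_gt0 ?len_gt0. Qed.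

Definition pi_curve (R : realType) (V H : finType) (n : nat)
    (G : graph V H n) (Gamma : curve R G) (S : spin G) : curve R G :=
  Curve (pi_len_subproof Gamma S).

(* The orbit of (Gamma, S) under Aut(Gamma). *)
Definition spin_orbit (R : realType) (V H : finType) (n : nat)
    (G : graph V H n) (Gamma : curve R G) (S : spin G) : set (spin G) :=
  [set S' | exists a : iso G G,
     (forall e, len Gamma (iso_edge a e) = len Gamma e) /\ spin_iso a S S'].

(* Main.v *)
(* Contractions are handled through the integers [2 * wt v - 2], which are additive
   along fibres: the value at a vertex of G/F is the sum over its fibre plus the
   number of contracted half-edges. This makes contractions composable and lets two
   contractions of the same graph factor through each other as soon as their
   contracted edges are nested. Hence every point of either complex has a positive
   representative (contract the edges of length zero), two positive representatives
   are isomorphic, and the fibres of pi are orbits of spin structures.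

   Purity: a graph with fewer than 3g-3+n edges is a one-edge contraction of another
   stable graph, and spin structures lift along one-edge contractions. Connectedness:
   the cones of a given parity share their origin, the one-vertex graph of weight g,
   and parity is locally constant on the complex. *)

From Stdlib Require Import Relation_Operators.
From mathcomp Require Import all_boot all_order all_algebra zify.
From mathcomp Require Import all_classical all_reals all_analysis.
Require Import Defs.

Set Implicit Arguments.
Unset Strict Implicit.
Unset Printing Implicit Defensive.

Import Order.TTheory GRing.Theory Num.Theory.

Local Open Scope ring_scope.

(** * Half-edges and genus *)

Section HalfEdgeSets.
Context {V H : finType} {n : nat} (G : graph V H n).
Implicit Types (K : {set H}) (F A : {set edge G}) (U : {set V}).

(** The vertices of G/F are subsets of V and its half-edges form a subtype of H, so an iterated
    quotient and a single one have different types. Contractions are therefore described from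
    outside, by maps and equations, in a form that isomorphisms and composites share. Sets of edges
    become sets of half-edges: a contraction embeds the half-edges of the target into those of the
    source, so edge sets of different graphs can be compared by image and preimage.

    The term 2 wt v - 2 is the contribution of a vertex to the Euler characteristic formula for 2g -
    2. Adding valences turns it into a formula for 2g - 2 + n whose local terms are positive by
    stability; the dimension and the finiteness of the diagrams both come from it.

    Two obstacles shape the topological part. In genus 0 every sign vanishes, so the odd locus is
    empty and there is a single component. And lengths may be infinite, where scaling a point down
    to the origin is not continuous, so finite points are treated first and the rest is reached by
    closure. *)

Definition hadj K : rel V := fun u v =>
  [exists h in K, (endpt G h == u) && (endpt G (invol G h) == v)].

Definition edgewise K : Prop :=
  forall h, h \in K -> invol G h \in K /\ invol G h != h.

(* Half the sum of [chi v] over the vertices plus the number of edges is the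
   genus minus one, so [chi] is additive under contractions. *)
Definition chi (v : V) : int := (2 * wt G v)%:Z - 2.

Lemma hadjP K u v : reflect (exists h, [/\ h \in K, endpt G h = u &
  endpt G (invol G h) = v]) (hadj K u v).
Proof.
apply: (iffP existsP) => [[h /and3P[hK /eqP<- /eqP<-]]|[h [hK <- <-]]].
  by exists h.
by exists h; rewrite hK !eqxx.
Qed.

Lemma connect1_half K h : h \in K ->
  connect (hadj K) (endpt G h) (endpt G (invol G h)).
Proof. by move=> hK; apply/connect1/hadjP; exists h. Qed.

Lemma hadj_sym K : edgewise K -> symmetric (hadj K).
Proof.
move=> eK; suff s u v : hadj K u v -> hadj K v u by move=> u v; apply/idP/idP => /s.
case/hadjP=> h [hK <- <-]; apply/hadjP; exists (invol G h).
by rewrite involK; split=> //; case: (eK _ hK).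
Qed.

Lemma hconnect_sym K : edgewise K -> connect_sym (hadj K).
Proof. by move=> eK; apply/sym_connect_sym/hadj_sym. Qed.

(* A connected graph on k vertices has at least k - 1 edges: grow a connected
   vertex set from v one vertex at a time. *)
Lemma tree_bound K v : edgewise K ->
  (2 * #|[set u | connect (hadj K) v u]| <=
   #|[set h in K | connect (hadj K) v (endpt G h)]| + 2)%N.
Proof.
move=> eK; pose C := [set u | connect (hadj K) v u].
pose T (S : {set V}) :=
  [set h in K | (endpt G h \in S) && (endpt G (invol G h) \in S)].
suff grow k : (k < #|C|)%N -> exists S : {set V},
    [/\ S \subset C, v \in S, #|S| = k.+1 & (2 * #|S| <= #|T S| + 2)%N].
  have Cgt0 : (0 < #|C|)%N by apply/card_gt0P; exists v; rewrite finset.inE.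
  have [] := grow #|C|.-1; first by rewrite prednK.
  move=> S [SC _ cS bS]; have {}SC : S = C.
    by apply/eqP; rewrite eqEcard SC cS prednK ?leqnn.
  rewrite -/C -SC; apply: leq_trans bS _; rewrite leq_add2r subset_leq_card //.
  apply/fintype.subsetP => h; rewrite !finset.inE => /and3P[-> + _].
  by rewrite SC finset.inE.
elim: k => [|k IHk] kC.
  exists [set v]; split; rewrite ?cards1 ?leq_addl ?finset.set11 //.
  by rewrite finset.sub1set finset.inE connect0.
have [S [SC vS cS bS]] := IHk (ltnW kC).
have [x [y [xS yS xy]]] : exists x y, [/\ x \in S, y \notin S & hadj K x y].
  apply: contrapT => nex; suff CS : C \subset S.
    by move: (subset_leq_card CS); rewrite cS leqNgt kC.
  apply/fintype.subsetP => u; rewrite finset.inE => vu.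
  rewrite -(@closed_connect _ (hadj K) S _ v u vu) //.
  apply: (intro_closed (hconnect_sym eK)) => x y xy xS.
  by apply: contrapT => /negP yS; apply: nex; exists x, y.
have /hadjP[h [hK hx hy]] := xy.
have [hiK hin] := eK _ hK.
exists (y |: S); split.
- rewrite finset.subUset SC finset.sub1set andbT finset.inE.
  move/fintype.subsetP/(_ _ xS): SC; rewrite finset.inE => /connect_trans; apply.
  exact: connect1.
- by rewrite finset.in_setU1 vS orbT.
- by rewrite cardsU1 yS cS.
(* The new vertex y brings both halves of the edge from x to y. Neither was in [T S], since y is an
   end of that edge and lies outside S. *)
have : (#|[set h; invol G h] :|: T S| <= #|T (y |: S)|)%N.
  apply: subset_leq_card; apply/fintype.subsetP => z; rewrite !finset.inE.
  case/orP=> [/orP[]/eqP->|/and3P[-> -> ->]]; rewrite ?hK ?hiK ?involK ?hx ?hy ?xS ?eqxx ?orbT //.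
rewrite cardsU (_ : _ :&: _ = finset.set0); last first.
  apply/setP => z; rewrite !finset.inE; apply/negP => /andP[/orP[]/eqP->].
    by rewrite hy (negPf yS) !andbF.
  by rewrite hy (negPf yS) !andbF.
rewrite cards0 subn0 cards2 eq_sym hin cardsU1 yS.
move: bS; lia.
Qed.

Lemma edge_halfE (e : edge G) h : h \in val e ->
  val e = [set h; invol G h] /\ invol G h != h.
Proof.
case: e => e /= /existsP[h0 /andP[hN /eqP->]]; rewrite !finset.inE.
case/orP=> /eqP->; first by [].
by rewrite involK finset.setUC eq_sym.
Qed.

Lemma edge_half (e : edge G) : exists h, h \in val e.
Proof.
by case: e => e /= /existsP[h0 /andP[hN /eqP->]]; exists h0; rewrite !finset.inE eqxx.
Qed.

Lemma edge_eq (e e' : edge G) h : h \in val e -> h \in val e' -> e = e'.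
Proof. by move=> /edge_halfE[E _] /edge_halfE[E' _]; apply: val_inj; rewrite E E'. Qed.

Lemma is_edge_half h : invol G h != h -> is_edge G [set h; invol G h].
Proof. by move=> hN; apply/existsP; exists h; rewrite hN eqxx. Qed.

Lemma half_edge h : invol G h != h -> exists e : edge G, h \in val e.
Proof.
move=> hN; exists (exist (fun e => is_edge G e) _ (is_edge_half hN)).
by rewrite /= !finset.inE eqxx.
Qed.

Lemma invol_edge (e : edge G) h : (invol G h \in val e) = (h \in val e).
Proof.
suff s x : x \in val e -> invol G x \in val e.
  by apply/idP/idP => [/s|/s//]; rewrite involK.
by move=> /edge_halfE[-> _]; rewrite !finset.inE eqxx orbT.
Qed.

Lemma halvesP F h : reflect (exists2 e, e \in F & h \in val e) (h \in halves F).
Proof. exact: bigcupP. Qed.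

Lemma mem_halves F (e : edge G) h : h \in val e -> (h \in halves F) = (e \in F).
Proof.
move=> he; apply/halvesP/idP => [[e' e'F he']|eF]; last by exists e.
by rewrite (edge_eq he he').
Qed.

Lemma halves_edgewise F : edgewise (halves F).
Proof.
move=> h hF; rewrite inv_halves hF; split=> //.
by case/halvesP: hF => e _ /edge_halfE[].
Qed.

Lemma halves_inj : injective (@halves V H n G).
Proof.
move=> F F' E; apply/setP => e; have [h he] := edge_half e.
by rewrite -!(mem_halves _ he) E.
Qed.

Definition edges_of K : {set edge G} := [set e : edge G | val e \subset K].

Lemma halves_edges_of K : edgewise K -> halves (edges_of K) = K.
Proof.
move=> eK; apply/setP => h; apply/halvesP/idP => [[e]|hK].
  by rewrite finset.inE => /fintype.subsetP; apply.
have [hiK /half_edge[e he]] := eK h hK; exists e => //.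
rewrite finset.inE; have [-> _] := edge_halfE he.
by rewrite finset.subUset !finset.sub1set hK.
Qed.

Lemma card_edge (e : edge G) : #|val e| = 2%N.
Proof. by have [h /edge_halfE[-> hN]] := edge_half e; rewrite cards2 eq_sym hN. Qed.

Lemma card_halves F : #|halves F| = (2 * #|F|)%N.
Proof.
have -> : halves F = finset.cover (val @: F) by rewrite finset.cover_imset.
have /eqP<- : finset.trivIset (val @: F).
  apply/finset.trivIsetP => _ _ /imsetP[e _ ->] /imsetP[e' _ ->] ee'.
  rewrite -finset.setI_eq0; apply/eqP/setP => h; rewrite !finset.inE.
  by apply/negP => /andP[he he']; rewrite (edge_eq he he') eqxx in ee'.
rewrite big_imset /=; last by move=> x y _ _; apply: val_inj.
by under eq_bigr => e _ do rewrite card_edge; rewrite sum_nat_const mulnC.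
Qed.

Lemma edgewise_even K : edgewise K -> ~~ odd #|K|.
Proof. by move=> /halves_edges_of<-; rewrite card_halves oddM. Qed.

(** There is one component, so the first Betti number is |A| + 1 - |U|, and [tree_bound] shows that
    the truncated subtraction in [betti1] is exact. Doubling counts every edge by its two halves. *)
Lemma subgenusE A U : U != finset.set0 ->
  (forall u v, u \in U -> v \in U -> connect (adj A) u v) ->
  (forall h, h \in halves A -> endpt G h \in U) ->
  (2 * subgenus A U)%:Z - 2 = \sum_(v in U) chi v + #|halves A|%:Z.
Proof.
move=> U0 conU hU.
have eA := @halves_edgewise A.
have cmp v : v \in U -> component A v = U.
  move=> vU; apply/setP => u; rewrite finset.inE; apply/idP/idP; last exact: conU.
  move=> vu; rewrite -(@closed_connect _ (adj A) U _ v u vu) //.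
  apply: (intro_closed (hconnect_sym eA)) => x y /hadjP[h [hA _ <-]] _.
  by apply: hU; case: (eA _ hA).
rewrite /subgenus /betti1; have -> : comps A U = [set U].
  apply/setP => C; rewrite finset.in_set1; apply/imsetP/eqP => [[v vU ->]|->].
    exact: cmp.
  by case/set0Pn: U0 => v vU; exists v; rewrite ?cmp.
rewrite cards1 /chi sumrB sumr_const.
have [v vU] := set0Pn _ U0.
have := tree_bound v eA.
rewrite -/(adj A) -/(component A v) (cmp v vU).
rewrite (_ : [set h in _ | _] = halves A); last first.
  apply/setP => h; rewrite !finset.inE andb_idr // => hA.
  exact: conU vU (hU _ hA).
rewrite card_halves => tb.
have -> : \sum_(v0 in U) (2 * wt G v0)%:Z = (2 * \sum_(v0 in U) wt G v0)%:Z.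
  by rewrite big_distrr /= (big_morph Posz PoszD (erefl : Posz 0 = 0)).
rewrite -mulr_natr.
move: (\sum_(i in U) _)%N => W; move: #|A| #|U| tb => a u; lia.
Qed.

End HalfEdgeSets.

(** * Contractions *)

Definition lost (H H' : finType) (f : H' -> H) : {set H} :=
  [set h | h \notin codom f].

(* A contraction G -> G' seen from outside: cV is the map on vertices, cH embeds
   the half-edges of G' into those of G, and the contracted half-edges are those
   outside the image of cH. The last field says that the weight of a vertex of G'
   is the genus of its fibre. *)
Record contr (V H V' H' : finType) (n : nat)
    (G : graph V H n) (G' : graph V' H' n) := Contr {
  cV : V -> V';
  cH : H' -> H;
  cH_inj : injective cH;
  cV_end : forall h, cV (endpt G (cH h)) = endpt G' h;
  cH_inv : forall h, invol G (cH h) = cH (invol G' h);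
  cH_leg : forall i, cH (leg G' i) = leg G i;
  cV_surj : forall v', exists v, cV v = v';
  cV_conn : forall u v, (cV u == cV v) = connect (hadj G (lost cH)) u v;
  cV_chi : forall v', chi G' v' = \sum_(v | cV v == v') chi G v +
    #|[set h in lost cH | cV (endpt G h) == v']|%:Z }.

Lemma sum1_cardz (T : finType) (P : pred T) :
  \sum_(x | P x) (1 : int) = #|[set x | P x]|%:Z.
Proof. by rewrite sumr_const cardsE -mulr_natr mul1r natz. Qed.

Lemma lostP (H H' : finType) (f : H' -> H) h :
  reflect (exists h', h = f h') (h \notin lost f).
Proof.
rewrite finset.inE negbK; apply: (iffP codomP) => [[h' ->]|[h' ->]]; by exists h'.
Qed.

Lemma lost_im (H H' : finType) (f : H' -> H) h' : f h' \notin lost f.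
Proof. by apply/lostP; exists h'. Qed.

Section Contr.
Context {V H V' H' : finType} {n : nat}.
Context {G : graph V H n} {G' : graph V' H' n} (m : contr G G').

(** The image of [cH] is stable under the involution and contains all legs, so its complement is a
    union of edges. *)
Lemma lost_edgewise : edgewise G (lost (cH m)).
Proof.
move=> h hl; split.
  apply: contraT => /lostP[h' E]; rewrite -(involK G h) E cH_inv in hl.
  by rewrite (negPf (lost_im _ _)) in hl.
apply/eqP => /(legP G h).1 [i E]; move: hl.
by rewrite E -(cH_leg m) (negPf (lost_im _ _)).
Qed.

Lemma contr_connect (K : {set H'}) u v :
  connect (hadj G (lost (cH m) :|: cH m @: K)) u v =
  connect (hadj G' K) (cV m u) (cV m v).
Proof.
apply/idP/idP => [/connectP[p]|/connectP[p]].
  elim: p u => [|w p IHp] u /= => [_ ->|/andP[uw pw] E]; first exact: connect0.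
  apply: connect_trans (IHp w pw E).
  have /hadjP[h [+ <- <-]] := uw.
  case/finset.setUP => [hl|/imsetP[h' h'K ->]].
    rewrite (_ : cV m _ = cV m (endpt G (invol G h))) ?connect0 //.
    by apply/eqP; rewrite cV_conn connect1_half.
  by rewrite cH_inv !cV_end connect1_half.
elim: p u => [|w' p IHp] u /= => [_ E|/andP[uw pw] E].
  have : connect (hadj G (lost (cH m))) u v by rewrite -cV_conn E.
  apply: connect_sub => x y /hadjP[h [hl <- <-]].
  by apply: connect1_half; rewrite finset.in_setU hl.
have /hadjP[h' [h'K E1 E2]] := uw.
have uh : connect (hadj G (lost (cH m))) u (endpt G (cH m h')).
  by rewrite -cV_conn cV_end E1.
apply: (@connect_trans _ _ (endpt G (cH m h'))).
  apply: connect_sub uh => x y /hadjP[h [hl <- <-]].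
  by apply: connect1_half; rewrite finset.in_setU hl.
apply: (@connect_trans _ _ (endpt G (invol G (cH m h')))).
  by apply: connect1_half; rewrite finset.in_setU imset_f // orbT.
by apply: IHp; rewrite cH_inv cV_end E2.
Qed.

Lemma chi_sum (P : pred V') :
  \sum_(v' | P v') chi G' v' = \sum_(v | P (cV m v)) chi G v +
    #|[set h in lost (cH m) | P (cV m (endpt G h))]|%:Z.
Proof.
under eq_bigr => v' _ do rewrite (cV_chi m) -sum1_cardz.
rewrite big_split /= -sum1_cardz; congr (_ + _).
  rewrite [RHS](partition_big (cV m) P) //=; apply: eq_bigr => v' Pv'.
  by apply: eq_bigl => v; case: eqP => [->|]; rewrite ?Pv' ?andbF.
rewrite [RHS](partition_big (fun h => cV m (endpt G h)) P) //=; last first.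
  by move=> h /andP[].
apply: eq_bigr => v' Pv'; apply: eq_bigl => h.
by case: eqP => [->|]; rewrite ?Pv' ?andbT ?andbF.
Qed.

Lemma card_lostU (K : {set H'}) (P : pred V') :
  #|[set h in lost (cH m) :|: cH m @: K | P (cV m (endpt G h))]| =
  (#|[set h in lost (cH m) | P (cV m (endpt G h))]| +
   #|[set h in K | P (endpt G' h)]|)%N.
Proof.
rewrite -(card_imset _ (cH_inj (c := m))) -cardsUI.
rewrite [X in (_ + X)%N](_ : _ = 0)%N ?addn0.
  apply: eq_card => h; rewrite !finset.inE.
  have [/codomP[h' ->]|hl] /= := boolP (h \in codom _).
    by rewrite !mem_imset ?finset.inE ?cV_end //; exact: cH_inj.
  case: (P _) => //=; apply/esym/imsetP => -[h' _ E].
  by rewrite E codom_f in hl.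
apply/eqP; rewrite cards_eq0; apply/eqP/setP => h; rewrite finset.in_set0.
apply/negP => /finset.setIP[+ /imsetP[h' _ E]].
by rewrite E finset.inE (negPf (lost_im _ _)).
Qed.

End Contr.

(** * Composition and factorization of contractions *)

Section Compose.
Context {V H V1 H1 V2 H2 : finType} {n : nat}.
Context {G : graph V H n} {G1 : graph V1 H1 n} {G2 : graph V2 H2 n}.

Lemma lost_comp (m1 : contr G G1) (f : H2 -> H1) :
  lost (cH m1 \o f) = lost (cH m1) :|: cH m1 @: lost f.
Proof.
apply/setP => h; apply/idP/idP => [hl|].
  rewrite finset.in_setU; case: (boolP (h \in lost (cH m1))) => //=.
  move=> /lostP[h1 E]; rewrite E imset_f //; apply: contraT => /lostP[h2 E2].
  by rewrite E E2 -[cH m1 _]/((cH m1 \o f) h2) (negPf (lost_im _ _)) in hl.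
move=> hU; apply: contraT => /lostP[h2 E]; move: hU; rewrite finset.in_setU E /=.
rewrite (negPf (lost_im _ _)) /= => /imsetP[h1 + /(cH_inj (c := m1)) E1].
by rewrite -E1 (negPf (lost_im _ _)).
Qed.

Lemma comp_subproof (m1 : contr G G1) (m2 : contr G1 G2) :
  exists m : contr G G2, cV m = cV m2 \o cV m1 /\ cH m = cH m1 \o cH m2.
Proof.
unshelve eexists; first unshelve eapply (@Contr _ _ _ _ _ G G2
   (cV m2 \o cV m1) (cH m1 \o cH m2)); last by [].
- exact: inj_comp (cH_inj (c := m1)) (cH_inj (c := m2)).
- by move=> h /=; rewrite !cV_end.
- by move=> h /=; rewrite !cH_inv.
- by move=> h /=; rewrite !cH_leg.
- move=> v2; have [v1 <-] := cV_surj m2 v2; have [v <-] := cV_surj m1 v1.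
  by exists v.
- by move=> u v; rewrite /= cV_conn lost_comp contr_connect.
- move=> v2; rewrite (cV_chi m2) (chi_sum m1) lost_comp.
  by rewrite (card_lostU m1 _ (fun v => cV m2 v == v2)) PoszD addrA.
Qed.

(** Extracted from an opaque existence proof, so that only its two equations below are ever used. *)
Definition contr_comp (m1 : contr G G1) (m2 : contr G1 G2) : contr G G2 :=
  projT1 (cid (comp_subproof m1 m2)).

Lemma contr_compV (m1 : contr G G1) (m2 : contr G1 G2) v :
  cV (contr_comp m1 m2) v = cV m2 (cV m1 v).
Proof. by rewrite /contr_comp; case: cid => m /= [-> _]. Qed.

Lemma contr_compH (m1 : contr G G1) (m2 : contr G1 G2) h :
  cH (contr_comp m1 m2) h = cH m1 (cH m2 h).
Proof. by rewrite /contr_comp; case: cid => m /= [_ ->]. Qed.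

(** The factor is m2 composed with a section of m1. The choice of section does not matter: fibres of
    m1 are connected by half-edges that m2 loses too, so they lie in fibres of m2. The condition on
    [chi] follows by expanding both sides over the vertices of G. *)
Lemma contr_factor (m1 : contr G G1) (m2 : contr G G2) :
  lost (cH m1) \subset lost (cH m2) ->
  exists m : contr G1 G2, (forall v, cV m (cV m1 v) = cV m2 v) /\
    (forall h, cH m1 (cH m h) = cH m2 h).
Proof.
move=> /fintype.subsetP sub.
have /choice[s sK] : forall v1, exists v, cV m1 v = v1 by exact: cV_surj.
have /choice[t tK] : forall h2, exists h1, cH m1 h1 = cH m2 h2.
  move=> h2; have /lostP[h1 ->] : cH m2 h2 \notin lost (cH m1).
    by apply/negP => /sub; rewrite (negPf (lost_im _ _)).
  by exists h1.
have E : cH m1 \o t = cH m2 by apply/funext => h; exact: tK.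
have lE : lost (cH m2) = lost (cH m1) :|: cH m1 @: lost t by rewrite -E lost_comp.
have sV v : cV m2 (s (cV m1 v)) = cV m2 v.
  apply/eqP; rewrite cV_conn.
  have : connect (hadj G (lost (cH m1))) (s (cV m1 v)) v by rewrite -cV_conn sK.
  apply: connect_sub => x y /hadjP[h [hl <- <-]].
  by apply: connect1_half; exact: sub.
unshelve eexists; first unshelve eapply (@Contr _ _ _ _ _ G1 G2 (cV m2 \o s) t).
- by move=> x y /(congr1 (cH m1)); rewrite !tK => /cH_inj.
- by move=> h /=; rewrite -(cV_end m1) sV tK cV_end.
- by move=> h; apply: (cH_inj (c := m1)); rewrite -cH_inv !tK cH_inv.
- by move=> i; apply: (cH_inj (c := m1)); rewrite tK !cH_leg.
- by move=> v2; have [v <-] := cV_surj m2 v2; exists (cV m1 v) => /=.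
- by move=> u v; rewrite /= cV_conn lE contr_connect !sK.
- move=> v2; rewrite (cV_chi m2) (chi_sum m1) lE -addrA -PoszD.
  rewrite -(card_lostU m1 (lost t) (fun v => (cV m2 \o s) v == v2)) /=.
  congr (_ + Posz _); first by apply: eq_bigl => v; rewrite sV.
  by apply: eq_card => h; rewrite !finset.inE sV.
by split=> [v|h] /=; [exact: sV | exact: tK].
Qed.

End Compose.

(** * The quotient graph G/F as a contraction *)

Section ConcreteContraction.
Context {V H : finType} {n : nat} (G : graph V H n) (F : {set edge G}).

Lemma cproj_eq u v : (cproj F u == cproj F v) = connect (adj F) u v.
Proof.
have cs := hconnect_sym (@halves_edgewise _ _ _ G F).
rewrite -val_eqE /=; apply/eqP/idP => [/setP/(_ v)|uv].
  by rewrite !finset.inE connect0.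
by apply/setP => w; rewrite !finset.inE; apply: same_connect cs _ _ uv w.
Qed.

Lemma mem_cvertex (C : cvertex F) v : (v \in val C) = (cproj F v == C).
Proof.
case: C => C /= CF; have /imsetP[u _ E] := CF.
rewrite -val_eqE /= E finset.inE.
have -> : (component F v == component F u) = (cproj F u == cproj F v).
  by rewrite eq_sym -val_eqE.
by rewrite cproj_eq.
Qed.

Lemma cprojP (C : cvertex F) : exists v, C = cproj F v.
Proof. by case: C => C /= CF; have /imsetP[u _ E] := CF; exists u; apply/val_inj. Qed.

Lemma lost_chalf : lost (val : chalf F -> H) = halves F.
Proof.
apply/setP => h; rewrite finset.inE; apply/negP/idP => [nc|hF /codomP[[x /= xF] E]].
  apply: contraT => hF; case: nc; apply/codomP.
  by exists (exist (fun h => h \notin halves F) h hF).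
by rewrite E (negPf xF) in hF.
Qed.

Lemma cproj_half h : h \in halves F ->
  cproj F (endpt G (invol G h)) = cproj F (endpt G h).
Proof.
move=> hF; apply/eqP; rewrite eq_sym cproj_eq.
exact: (@connect1_half _ _ _ G _ _ hF).
Qed.

(** The edge set whose subgenus is, by [cwt], the weight of C. *)
Definition incident (C : cvertex F) : {set edge G} :=
  [set e in F | [forall h in val e, endpt G h \in val C]].

Lemma halves_incident (C : cvertex F) :
  halves (incident C) = [set h in halves F | cproj F (endpt G h) == C].
Proof.
apply/setP => h; rewrite finset.inE -mem_cvertex.
apply/halvesP/andP => [[e]|[/halvesP[e eF he] hC]].
  rewrite finset.inE => /andP[eF /forall_inP eC] he.
  by rewrite eC // (mem_halves _ he).
exists e => //; rewrite finset.inE eF /=; apply/forall_inP => x.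
have [-> _] := edge_halfE he; rewrite !finset.inE => /orP[]/eqP-> //.
rewrite mem_cvertex cproj_half -?mem_cvertex //.
by apply/halvesP; exists e.
Qed.

Lemma chi_contraction (C : cvertex F) :
  chi (contraction F) C = \sum_(v in val C) chi G v + #|halves (incident C)|%:Z.
Proof.
rewrite -subgenusE //.
- by have [v ->] := cprojP C; apply/set0Pn; exists v; rewrite mem_cvertex.
- move=> u v uC vC.
  have : connect (adj F) u v.
    by move: uC vC; rewrite !mem_cvertex -cproj_eq => /eqP-> /eqP->.
  (* A path along F that starts in the component C never leaves it, so it uses only edges incident
     to C. *)
  case/connectP=> p; elim: p u uC => [|w p IHp] u uC /= => [_ ->|]; first exact: connect0.
  case/andP => /hadjP[h [hF E1 E2]] pw E; have wC : w \in val C.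
    by move: uC; rewrite !mem_cvertex -E2 cproj_half // E1.
  apply: connect_trans (IHp w wC pw E); apply/connect1/hadjP; exists h; split=> //.
  by rewrite halves_incident finset.inE hF E1 -mem_cvertex.
by move=> h; rewrite halves_incident finset.inE -mem_cvertex => /andP[].
Qed.

Lemma contr_of_subproof : exists m : contr G (contraction F),
  cV m = cproj F /\ cH m = val.
Proof.
unshelve eexists; first unshelve eapply (@Contr _ _ _ _ _ G (contraction F)
   (cproj F) val); last by [].
- exact: val_inj.
- by [].
- by [].
- by [].
- by move=> C; have [v ->] := cprojP C; exists v.
- by move=> u v; rewrite lost_chalf cproj_eq.
- move=> C; rewrite chi_contraction lost_chalf halves_incident; congr (_ + _).
  by apply: eq_bigl => v; rewrite mem_cvertex.
Qed.

Definition contr_of : contr G (contraction F) := projT1 (cid contr_of_subproof).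

Lemma contr_ofV v : cV contr_of v = cproj F v.
Proof. by rewrite /contr_of; case: cid => m /= [-> _]. Qed.

Lemma contr_ofH h : cH contr_of h = val h.
Proof. by rewrite /contr_of; case: cid => m /= [_ ->]. Qed.

Lemma lost_contr_of : lost (cH contr_of) = halves F.
Proof. by rewrite -lost_chalf; congr lost; apply/funext => h; exact: contr_ofH. Qed.

End ConcreteContraction.

(** * Isomorphisms as contractions that lose nothing *)

Section Iso.
Context {V H V' H' : finType} {n : nat}.
Context {G : graph V H n} {G' : graph V' H' n}.

Lemma connect_set0 u v : connect (hadj G finset.set0) u v = (u == v).
Proof.
apply/idP/eqP => [/connectP[[|w p] /=]|->]; last exact: connect0.
  by move=> _ ->.
by case/andP=> /hadjP[h []]; rewrite finset.in_set0.
Qed.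

Lemma lost0 (T T' : finType) (f : T' -> T) :
  (forall x, exists x', x = f x') -> lost f = finset.set0.
Proof.
move=> fs; apply/setP => h; rewrite finset.in_set0; apply: negbTE.
by apply/lostP; exact: fs.
Qed.

Lemma contr_iso_subproof (a : iso G G') : exists m : contr G G',
  (forall v, cV m v = isoV a v) /\ (forall h, isoH a (cH m h) = h).
Proof.
have [g gK Kg] := isoH_bij a.
have l0 : lost g = finset.set0.
  by apply: lost0 => h; exists (isoH a h); rewrite gK.
have [vg vgK Kvg] := isoV_bij a.
unshelve eexists; first unshelve eapply (@Contr _ _ _ _ _ G G' (isoV a) g).
- exact: can_inj Kg.
- by move=> h; rewrite -iso_endpt Kg.
- by move=> h; rewrite -{2}[h]Kg iso_inv gK.
- by move=> i; rewrite (iso_leg a) gK.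
- by move=> v'; exists (vg v'); rewrite Kvg.
- by move=> u v; rewrite l0 connect_set0 (can_eq vgK).
- move=> v'; rewrite (big_pred1 (vg v')) => [|v]; last first.
    by rewrite /= (can2_eq vgK Kvg).
  rewrite l0 (_ : [set _ in _ | _] = finset.set0) ?cards0 ?addr0; last first.
    by apply/setP => h; rewrite !finset.inE.
  by rewrite /chi -(iso_wt a) Kvg.
by split=> // h /=; rewrite Kg.
Qed.

Definition contr_iso (a : iso G G') : contr G G' :=
  projT1 (cid (contr_iso_subproof a)).

Lemma contr_isoV a v : cV (contr_iso a) v = isoV a v.
Proof. by rewrite /contr_iso; case: cid => m /= [-> _]. Qed.

Lemma contr_isoH a h : isoH a (cH (contr_iso a) h) = h.
Proof. by rewrite /contr_iso; case: cid => m /= [_ ->]. Qed.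

Lemma lost_contr_iso a : lost (cH (contr_iso a)) = finset.set0.
Proof.
apply: lost0 => h; exists (isoH a h); apply: (bij_inj (isoH_bij a)).
by rewrite contr_isoH.
Qed.

(** With nothing lost, fibres are single vertices and [cV_chi] reduces to equality of weights. *)
Lemma iso_of_contr (m : contr G G') : lost (cH m) = finset.set0 ->
  exists a : iso G G', (forall v, isoV a v = cV m v) /\
    (forall h, isoH a (cH m h) = h).
Proof.
move=> l0; have vinj : injective (cV m).
  by move=> u v /eqP; rewrite cV_conn l0 connect_set0 => /eqP.
have /choice[g gK] : forall h, exists h', cH m h' = h.
  move=> h; have /lostP[h' ->] : h \notin lost (cH m) by rewrite l0 finset.in_set0.
  by exists h'.
have Kg h' : g (cH m h') = h' by apply: (cH_inj (c := m)); rewrite gK.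
have /choice[s sK] : forall v', exists v, cV m v = v' by exact: cV_surj.
unshelve eexists; first unshelve eapply (@Iso _ _ _ _ _ G G' (cV m) g).
- by exists s => // v; apply: vinj; rewrite sK.
- by exists (cH m).
- by move=> h; rewrite -(cV_end m) gK.
- by move=> h; apply: (cH_inj (c := m)); rewrite -cH_inv !gK.
- move=> v; have := cV_chi m (cV m v); rewrite (big_pred1 v) => [|u]; last first.
    by rewrite /= (inj_eq vinj).
  rewrite l0 (_ : [set _ in _ | _] = finset.set0) ?cards0 ?addr0; last first.
    by apply/setP => h; rewrite !finset.inE.
  by rewrite /chi; lia.
- by move=> i; apply: (cH_inj (c := m)); rewrite gK cH_leg.
by [].
Qed.

End Iso.

(** * Genus, valence and stability *)

Section Invariants.
Context {V H : finType} {n : nat} (G : graph V H n).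

Definition valence (v : V) : nat := #|[set h | endpt G h == v]|.

Lemma mem_halvesT h : (h \in halves [set: edge G]) = (invol G h != h).
Proof.
apply/halvesP/idP => [[e _ /edge_halfE[]]//|/half_edge[e he]].
by exists e.
Qed.

Lemma connected_graphP :
  connected_graph G <-> forall u v, connect (adj [set: edge G]) u v.
Proof.
rewrite /connected_graph; split=> [/eqP/cards1P[C E] u v|con].
  have inC w : component [set: edge G] w = C.
    apply/finset.set1P; rewrite -E; apply: imset_f; exact: finset.in_setT.
  by have := inC u; rewrite -(inC v) => /setP/(_ v); rewrite !finset.inE connect0.
have /card_gt0P[v _] := graph_vertex G.
rewrite (_ : comps _ _ = [set component [set: edge G] v]) ?cards1 //.
apply/setP => C; rewrite finset.in_set1; apply/imsetP/eqP => [[u _ ->]|->].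
  by apply/setP => w; rewrite !finset.inE !con.
by exists v.
Qed.

Lemma genusE : connected_graph G ->
  (2 * genus G)%:Z - 2 = \sum_v chi G v + #|halves [set: edge G]|%:Z.
Proof.
move=> /connected_graphP con; rewrite /genus subgenusE //.
  by congr (_ + _); apply: eq_bigl => v; rewrite finset.inE.
by have /card_gt0P[v _] := graph_vertex G; apply/set0Pn; exists v.
Qed.

Lemma card_half_leg : #|H| = (2 * #|edge G| + n)%N.
Proof.
have -> : (2 * #|edge G| = #|halves [set: edge G]|)%N by rewrite card_halves cardsT.
rewrite -cardsT -(finset.setID [set: H] (halves [set: edge G])).
rewrite cardsU (_ : _ :&: (_ :\: _) = finset.set0); last first.
  by apply/setP => h; rewrite !finset.inE; case: (h \in halves _).
rewrite cards0 subn0 finset.setTI; congr (_ + _)%N.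
rewrite -[RHS]card_ord -cardsT -(card_imset _ (leg_inj (g := G))).
apply: eq_card => h; rewrite !finset.inE mem_halvesT negbK andbT.
apply/eqP/imsetP => [/legP[i ->]|[i _ ->]]; first by exists i.
by apply/legP; exists i.
Qed.

Lemma valenceE v : valence v = (deg G v + legs G v)%N.
Proof.
rewrite /valence /deg /legs -(card_imset _ (leg_inj (g := G))) -cardsUI.
rewrite [X in (_ + X)%N](_ : _ = 0)%N ?addn0; last first.
  apply/eqP; rewrite cards_eq0; apply/eqP/setP => h; rewrite finset.in_set0.
  apply/negP => /finset.setIP[+ /imsetP[i _ E]]; rewrite finset.inE => /andP[_ /negP].
  by apply; apply/eqP/legP; exists i.
apply: eq_card => h; rewrite !finset.inE.
have [/legP[i ->]|hN] /= := eqVneq (invol G h) h.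
  rewrite mem_imset ?finset.inE; last exact: leg_inj.
  by case: (_ == v); rewrite ?orbT ?andbF.
rewrite andbT; case: (_ == v) => //=; apply/esym/imsetP => -[i _ E].
by move/eqP: hN; apply; apply/legP; exists i.
Qed.

Lemma stableP : stable G <->
  connected_graph G /\ forall v, 0 < chi G v + (valence v)%:Z.
Proof.
rewrite /stable; split=> -[? st]; split=> // v; have := st v;
  rewrite valenceE /chi; lia.
Qed.

Lemma sum_valence (T : finType) (f : V -> T) (P : pred T) :
  \sum_(v | P (f v)) (valence v)%:Z = #|[set h | P (f (endpt G h))]|%:Z.
Proof.
rewrite -sum1_cardz (partition_big (endpt G) (fun v => P (f v))) //=.
apply: eq_bigr => v Pv; rewrite /valence -sum1_cardz; apply: eq_bigl => h.
by case: eqP => [->|]; rewrite ?Pv ?andbF.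
Qed.

(** In a stable graph every summand is at least one, so 2g - 2 + n bounds the number of vertices and
    each summand. In a weightless trivalent graph all summands equal one. *)
Lemma sum_chi_valence : connected_graph G ->
  \sum_v (chi G v + (valence v)%:Z) = (2 * genus G)%:Z - 2 + n%:Z.
Proof.
move=> con; rewrite big_split /= (sum_valence id predT) genusE // -addrA.
rewrite -PoszD card_halves cardsT -card_half_leg; congr (_ + Posz _).
by apply: eq_card => h; rewrite finset.inE.
Qed.

End Invariants.

Section ContrInvariants.
Context {V H V' H' : finType} {n : nat}.
Context {G : graph V H n} {G' : graph V' H' n} (m : contr G G').

Lemma halvesT_contr : halves [set: edge G] =
  lost (cH m) :|: cH m @: halves [set: edge G'].
Proof.
apply/setP => h; rewrite finset.in_setU mem_halvesT.
have [hl|/lostP[h' ->]] := boolP (h \in lost (cH m)).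
  by case: (lost_edgewise hl) => _ ->.
rewrite mem_imset; last exact: cH_inj.
by rewrite mem_halvesT cH_inv (inj_eq (cH_inj (c := m))).
Qed.

Lemma contr_connected : connected_graph G <-> connected_graph G'.
Proof.
rewrite !connected_graphP /adj -!/(hadj _ _).
have E u v : connect (hadj G (halves [set: edge G])) u v =
    connect (hadj G' (halves [set: edge G'])) (cV m u) (cV m v).
  by rewrite -contr_connect -halvesT_contr.
split=> con u v; last by rewrite E con.
by have [x <-] := cV_surj m u; have [y <-] := cV_surj m v; rewrite -E con.
Qed.

(** In [genusE] the contracted half-edges merely move from the edge count into the sum of [chi]. *)
Lemma contr_genus : connected_graph G -> genus G' = genus G.
Proof.
move=> con; have con' : connected_graph G' by exact/contr_connected.
have := genusE con; have := genusE con'; rewrite (chi_sum m predT) /=.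
have -> : #|halves [set: edge G]| =
    (#|[set h in lost (cH m) | true]| + #|halves [set: edge G']|)%N.
  have -> : #|halves [set: edge G']| = #|[set h in halves [set: edge G'] | true]|.
    by apply: eq_card => h; rewrite finset.inE andbT.
  rewrite -(card_lostU m _ predT); apply: eq_card => h.
  by rewrite finset.inE andbT -halvesT_contr.
move=> E1 E2; lia.
Qed.

Lemma contr_valence (P : pred V') :
  (#|[set h in lost (cH m) | P (cV m (endpt G h))]| +
   #|[set h | P (endpt G' h)]|)%N = #|[set h | P (cV m (endpt G h))]|.
Proof.
have -> : [set h | P (endpt G' h)] = [set h in [set: H'] | P (endpt G' h)].
  by apply/setP => h; rewrite !finset.inE.
rewrite -card_lostU; apply: eq_card => h; rewrite !finset.inE.
have [/codomP[h' ->]|//] := boolP (h \in codom _).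
by rewrite imset_f ?orbT // finset.in_setT.
Qed.

(** The contracted half-edges are added to [chi] and removed from the valence, so [chi] plus valence
    at a vertex is the sum of the same quantity over its fibre. *)
Lemma contr_stable : stable G -> stable G'.
Proof.
move=> /stableP[con st]; apply/stableP; split; first exact/contr_connected.
move=> v'; have : 0 < \sum_(v | cV m v == v') (chi G v + (valence G v)%:Z).
  have [v Ev] := cV_surj m v'; rewrite (bigD1 v) ?Ev //=.
  by apply: ltr_wpDr; [apply: sumr_ge0 => u _; exact/ltW | exact: st].
rewrite big_split /= (sum_valence G (cV m) (pred1 v')) /=.
rewrite -(contr_valence (pred1 v')) (cV_chi m) /valence /=.
move: (\sum_(v | _) _) => s; lia.
Qed.

(** The fibre is connected, so by [tree_bound] its contracted half-edges compensate the -2 of all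
    vertices but one. Consequently only weightless vertices lie over a weightless one, and
    pushed-forward signs vanish there. *)
Lemma wt_fibre v : (wt G v <= wt G' (cV m v))%N.
Proof.
have := tree_bound v (@lost_edgewise _ _ _ _ _ _ _ m).
have := cV_chi m (cV m v).
rewrite (_ : [set h in _ | connect _ _ _] =
    [set h in lost (cH m) | cV m (endpt G h) == cV m v]); last first.
  by apply/setP => h; rewrite !finset.inE eq_sym cV_conn.
rewrite (_ : [set u | _] = [set u | cV m u == cV m v]); last first.
  by apply/setP => u; rewrite !finset.inE eq_sym cV_conn.
rewrite /chi sumrB sumr_const -mulr_natr.
rewrite (_ : #|[pred _ | _]| = #|[set u | cV m u == cV m v]|); last first.
  by apply: eq_card => u; rewrite !inE.
rewrite -(big_morph Posz PoszD (erefl : Posz 0 = 0)) -big_distrr /=.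
have : (wt G v <= \sum_(u | cV m u == cV m v) wt G u)%N.
  by rewrite (bigD1 v) //= leq_addr.
move: (\sum_(u | _) _)%N #|[set u | _]| #|[set h in _ | _]| => a b c; lia.
Qed.

End ContrInvariants.

(** * Push-forward of spin structures *)

Section IdentityContr.
Context {V H : finType} {n : nat} (G : graph V H n).

Lemma contr_id_subproof : exists m : contr G G, cV m = id /\ cH m = id.
Proof.
have l0 : lost (@id H) = finset.set0 by apply: lost0 => h; exists h.
unshelve eexists; first unshelve eapply (@Contr _ _ _ _ _ G G id id); last by [].
- by [].
- by [].
- by [].
- by [].
- by move=> v; exists v.
- by move=> u v; rewrite l0 connect_set0.
- move=> v; rewrite (big_pred1 v) // l0.
  rewrite (_ : [set _ in _ | _] = finset.set0) ?cards0 ?addr0 //.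
  by apply/setP => h; rewrite !finset.inE.
Qed.

Definition contr_id : contr G G := projT1 (cid contr_id_subproof).

Lemma contr_idV v : cV contr_id v = v.
Proof. by rewrite /contr_id; case: cid => m /= [-> _]. Qed.

Lemma contr_idH h : cH contr_id h = h.
Proof. by rewrite /contr_id; case: cid => m /= [_ ->]. Qed.

End IdentityContr.

Lemma contr_inv (V H V' H' : finType) (n : nat) (G : graph V H n)
    (G' : graph V' H' n) (m : contr G G') : lost (cH m) = finset.set0 ->
  exists m' : contr G' G, [/\ forall v, cV m' (cV m v) = v,
    forall v, cV m (cV m' v) = v, forall h, cH m (cH m' h) = h &
    forall h, cH m' (cH m h) = h].
Proof.
move=> l0; have [|m' [V1 H1]] := @contr_factor _ _ _ _ _ _ _ _ _ _ m (contr_id G).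
  by rewrite l0 finset.sub0set.
have E v : cV m' (cV m v) = v by rewrite V1 contr_idV.
have E' h : cH m (cH m' h) = h by rewrite H1 contr_idH.
exists m'; split=> // [v|h].
  by have [u <-] := cV_surj m v; rewrite E.
by apply: (cH_inj (c := m)); rewrite E'.
Qed.

Section Push.
Context {V H V' H' : finType} {n : nat}.
Context {G : graph V H n} {G' : graph V' H' n} (m : contr G G').

(** This is the induced contraction in the definition of the push-forward. The composite from G to
    G'/P' loses all of P, hence factors through G/P. *)
Lemma quotient_contr (P : {set edge G}) (P' : {set edge G'}) :
  (forall h', (cH m h' \in halves P) = (h' \in halves P')) ->
  exists q : contr (contraction P) (contraction P'),
    (forall v, cV q (cproj P v) = cproj P' (cV m v)) /\
    (forall h, val (cH q h) = cH m (val h)).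
Proof.
move=> PP'.
have [|q [qV qH]] := @contr_factor _ _ _ _ _ _ _ _ _ _
   (contr_of P) (contr_comp m (contr_of P')).
  apply/fintype.subsetP => h; rewrite lost_contr_of => hP.
  apply: contraT => /lostP[h' E]; move: hP.
  rewrite E contr_compH contr_ofH PP'.
  by case: h' {E} => h' /= /negPf->.
exists q; split=> [v|h].
  by have := qV v; rewrite contr_compV !contr_ofV.
by have := qH h; rewrite contr_compH !contr_ofH.
Qed.

(* S' is the image of S; the map q is G/P -> G'/P'. *)
Definition push (S : spin G) (S' : spin G') : Prop :=
  (forall h', (cH m h' \in halves (cyc S)) = (h' \in halves (cyc S'))) /\
  exists2 q : contr (contraction (cyc S)) (contraction (cyc S')),
    (forall v, cV q (cproj (cyc S) v) = cproj (cyc S') (cV m v)) &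
    forall C', sgn S' C' = \sum_(C | cV q C == C') sgn S C.

Lemma push_parity S S' : push S S' -> parity S' = parity S.
Proof.
case=> _ [q _ E]; rewrite /parity [RHS](partition_big (cV q) predT) //=.
by apply: eq_bigr => C' _; rewrite E.
Qed.

(* The half-edges of P at a fibre of m, minus the contracted ones (which pair up
   inside the fibre), are the half-edges of P' at the image vertex. *)
Lemma cyclic_push (P : {set edge G}) (P' : {set edge G'}) :
  (forall h', (cH m h' \in halves P) = (h' \in halves P')) ->
  cyclic P -> cyclic P'.
Proof.
move=> PP' cP v'.
pose K1 := [set h in halves P | (h \in lost (cH m)) && (cV m (endpt G h) == v')].
have eK1 : edgewise G K1.
  move=> h; rewrite finset.inE => /and3P[hP hl hv].
  have [il iN] := lost_edgewise hl; split=> //.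
  rewrite finset.inE inv_halves hP il /= -(eqP hv) eq_sym cV_conn.
  exact: connect1_half.
have : ~~ odd #|[set h in halves P | cV m (endpt G h) == v']|.
  rewrite -sum1_card (partition_big (endpt G) (fun v => cV m v == v')) /=; last first.
    by move=> h; rewrite finset.inE => /andP[].
  rewrite big_mkcond; elim/big_ind: _ => // [x y|v _].
    by rewrite oddD => /negPf-> /negPf->.
  case: ifP => // vv'; have := cP v; rewrite -sum1_card.
  congr (~~ odd _); apply: eq_bigl => h; rewrite !finset.inE.
  by case: eqP => [->|]; rewrite ?vv' ?andbT ?andbF.
have -> : #|[set h in halves P | cV m (endpt G h) == v']| =
    (#|K1| + #|[set h in halves P' | endpt G' h == v']|)%N.
  rewrite -(card_imset _ (cH_inj (c := m))) -cardsUI.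
  rewrite [X in (_ + X)%N](_ : _ = 0)%N ?addn0.
    apply: eq_card => h; rewrite finset.in_setU !finset.inE.
    have [/codomP[h' ->]|hl] /= := boolP (h \in codom _).
      rewrite mem_imset ?finset.inE ?cV_end ?PP' //; last exact: cH_inj.
      by rewrite andbF.
    have /negPf-> : h \notin cH m @: [set h' in halves P' | endpt G' h' == v'].
      by apply/imsetP => -[h' _ E]; rewrite E codom_f in hl.
    by rewrite orbF.
  apply/eqP; rewrite cards_eq0; apply/eqP/setP => h; rewrite finset.in_set0.
  apply/negP => /finset.setIP[+ /imsetP[h' _ E]].
  by rewrite E finset.inE (negPf (lost_im _ _)) andbF.
by rewrite oddD (negPf (edgewise_even eK1)).
Qed.

Lemma push_exists (S : spin G) : exists S', push S S'.
Proof.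
pose K' := [set h' | cH m h' \in halves (cyc S)].
have eK' : edgewise G' K'.
  move=> h; rewrite !finset.inE => hK; rewrite -cH_inv inv_halves hK; split=> //.
  by case: (halves_edgewise hK) => _; rewrite cH_inv (inj_eq (cH_inj (c := m))).
have PP' h' : (cH m h' \in halves (cyc S)) = (h' \in halves (edges_of G' K')).
  by rewrite halves_edges_of // finset.inE.
have [q [qV _]] := quotient_contr PP'.
unshelve eexists; first unshelve eapply (@Spin _ _ _ G' (edges_of G' K')
   (fun C' => \sum_(C | cV q C == C') sgn S C)).
- exact: cyclic_push PP' (@cycP _ _ _ _ S).
- move=> C' w0; apply: big1 => C /eqP CC'; apply: sgnP.
  by apply/eqP; rewrite -leqn0 -w0 -CC'; exact: wt_fibre.
by split=> //; exists q.
Qed.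

Lemma quotient_unique (P : {set edge G}) (P' : {set edge G'})
    (f g : cvertex P -> cvertex P') :
  (forall v, f (cproj P v) = cproj P' (cV m v)) ->
  (forall v, g (cproj P v) = cproj P' (cV m v)) -> f =1 g.
Proof. by move=> fE gE C; have [v ->] := cprojP C; rewrite fE gE. Qed.

(** The map on quotient vertices is determined by commuting with the projections, so any function
    that does so may replace the one given by [push]. *)
Lemma pushE (S : spin G) (S' : spin G') (f : cvertex (cyc S) -> cvertex (cyc S')) :
  (forall v, f (cproj (cyc S) v) = cproj (cyc S') (cV m v)) ->
  push S S' <->
  (forall h', (cH m h' \in halves (cyc S)) = (h' \in halves (cyc S'))) /\
  forall C', sgn S' C' = \sum_(C | f C == C') sgn S C.
Proof.
move=> fE; split=> -[PP' sE]; split=> //.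
  case: sE => q qV sE C'; rewrite sE; apply: eq_bigl => C.
  by rewrite (quotient_unique fE qV).
have [q [qV _]] := quotient_contr PP'; exists q => // C'.
by rewrite sE; apply: eq_bigl => C; rewrite (quotient_unique fE qV).
Qed.

End Push.

Section PushFunctor.
Context {V H V1 H1 V2 H2 : finType} {n : nat}.
Context {G : graph V H n} {G1 : graph V1 H1 n} {G2 : graph V2 H2 n}.
Context (m1 : contr G G1) (m2 : contr G G2) (m : contr G1 G2).
Hypothesis mV : forall v, cV m (cV m1 v) = cV m2 v.
Hypothesis mH : forall h, cH m1 (cH m h) = cH m2 h.
Context (S : spin G) (S1 : spin G1) (S2 : spin G2).

Lemma push_trans : push m1 S S1 -> push m S1 S2 -> push m2 S S2.
Proof.
case=> c1 [q1 q1V s1] [c [q qV s]].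
apply/(@pushE _ _ _ _ _ _ _ m2 _ _ (cV q \o cV q1)).
  by move=> v /=; rewrite q1V qV mV.
split=> [h|C2]; first by rewrite -mH c1 c.
rewrite s [RHS](partition_big (cV q1) (fun C1 => cV q C1 == C2)) //=.
apply: eq_bigr => C1 E; rewrite s1; apply: eq_bigl => C.
by case: (cV q1 C =P C1) => [->|]; rewrite ?E ?andbF.
Qed.

(** The fibres of q1 refine those of q2, and the partial sums over them are the signs of S1. Thus
    arrows between spin graphs inherit the factorizations of the underlying contractions. *)
Lemma push_factor : push m1 S S1 -> push m2 S S2 -> push m S1 S2.
Proof.
case=> c1 [q1 q1V s1] [c2 [q2 q2V s2]].
have c h : (cH m h \in halves (cyc S1)) = (h \in halves (cyc S2)).
  by rewrite -c1 mH c2.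
have [q [qV _]] := quotient_contr c.
have qq C : cV q (cV q1 C) = cV q2 C.
  by have [v ->] := cprojP C; rewrite q1V qV q2V mV.
split=> //; exists q => // C2.
rewrite s2 [LHS](partition_big (cV q1) (fun C1 => cV q C1 == C2)) /=.
  apply: eq_bigr => C1 /eqP E; rewrite s1; apply: eq_bigl => C.
  by case: (cV q1 C =P C1) => [E1|]; rewrite ?andbF // andbT -qq E1 E eqxx.
by move=> C; rewrite -qq.
Qed.

End PushFunctor.

Lemma push_id (V H : finType) (n : nat) (G : graph V H n) (S : spin G) :
  push (contr_id G) S S.
Proof.
apply/(@pushE _ _ _ _ _ _ _ (contr_id G) S S id).
  by move=> v; rewrite contr_idV.
split=> [h|C]; first by rewrite contr_idH.
by rewrite (big_pred1 C).
Qed.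

Lemma push_inv (V H V' H' : finType) (n : nat) (G : graph V H n)
    (G' : graph V' H' n) (m : contr G G') (m' : contr G' G) S S' :
  (forall v, cV m' (cV m v) = v) -> (forall h, cH m (cH m' h) = h) ->
  push m S S' -> push m' S' S.
Proof.
move=> mV mH p; apply: push_factor p (push_id S) => [v|h].
  by rewrite mV contr_idV.
by rewrite mH contr_idH.
Qed.

Section PushCompatibility.
Context {V H V' H' : finType} {n : nat}.
Context {G : graph V H n} {G' : graph V' H' n}.

Lemma halves_iso (a : iso G G') (F : {set edge G}) h :
  (isoH a h \in halves (iso_edge a @: F)) = (h \in halves F).
Proof.
have ainj := bij_inj (isoH_bij a).
apply/halvesP/halvesP => [[_ /imsetP[e eF ->]]|[e eF he]].
  by rewrite /= mem_imset // => he; exists e.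
by exists (iso_edge a e); rewrite ?imset_f //= mem_imset.
Qed.

Lemma spin_isoE (a : iso G G') (S : spin G) (S' : spin G') :
  spin_iso a S S' <-> push (contr_iso a) S S'.
Proof.
set m := contr_iso a.
have cE : cyc S' = (iso_edge a @: cyc S) <->
    (forall h', (cH m h' \in halves (cyc S)) = (h' \in halves (cyc S'))).
  split=> [-> h'|E]; first by rewrite -{2}[h'](contr_isoH a) halves_iso.
  apply: halves_inj; apply/setP => h'; rewrite -E.
  by rewrite -{2}[h'](contr_isoH a) halves_iso.
suff sE : (forall h', (cH m h' \in halves (cyc S)) = (h' \in halves (cyc S'))) ->
    forall q : contr (contraction (cyc S)) (contraction (cyc S')),
    (forall v, cV q (cproj (cyc S) v) = cproj (cyc S') (cV m v)) ->
    (forall v, sgn S' (cproj (cyc S') (isoV a v)) = sgn S (cproj (cyc S) v)) <->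
    forall C', sgn S' C' = \sum_(C | cV q C == C') sgn S C.
  split=> [[/cE c sg]|[c [q qV sg]]].
    have [q [qV _]] := quotient_contr c; split=> //; exists q => //.
    exact/(sE c q qV).
  by split; [exact/cE | exact/(sE c q qV)].
move=> c q qV.
(* Nothing is known about q on half-edges. The contraction q' agrees with it on vertices and loses
   nothing, so its fibres are points, and each sum in [push] has a single term. *)
have qinj : injective (cV q).
  have [q' [q'V q'H]] := quotient_contr c.
  have qq' : cV q =1 cV q' := quotient_unique (m := m) qV q'V.
  have l0 : lost (cH q') = finset.set0.
    apply: lost0 => h.
    have hP : isoH a (val h) \notin halves (cyc S').
      have := valP h; rewrite -{1}[val h](_ : cH m (isoH a (val h)) = _) ?c //.
      by apply: (bij_inj (isoH_bij a)); rewrite contr_isoH.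
    exists (exist (fun x => x \notin halves (cyc S')) _ hP); apply: val_inj.
    rewrite q'H /=; apply: (bij_inj (isoH_bij a)); exact/esym/contr_isoH.
  move=> x y; rewrite !qq' => /eqP; rewrite cV_conn l0 connect_set0.
  by move/eqP.
have sum1 v : \sum_(C | cV q C == cproj (cyc S') (isoV a v)) sgn S C =
    sgn S (cproj (cyc S) v).
  rewrite (big_pred1 (cproj (cyc S) v)) // => C /=.
  by rewrite -(contr_isoV a) -qV (inj_eq qinj).
split=> [sg C'|sg v]; last by rewrite sg sum1.
have [v' ->] := cprojP C'; have [v <-] := cV_surj m v'.
by rewrite contr_isoV sum1 sg.
Qed.

Lemma halves_uncontract (F P : {set edge G}) (h : chalf F) :
  (h \in halves [set e : edge (contraction F) | uncontract e \in P]) =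
  (val h \in halves P).
Proof.
apply/halvesP/idP => [[e]|hP].
  rewrite finset.inE => eP he; apply/halvesP; exists (uncontract e) => //.
  by rewrite /= imset_f.
have hN : invol (contraction F) h != h.
  by rewrite -val_eqE /=; case: (halves_edgewise hP).
have [e he] := half_edge hN; exists e => //.
by rewrite finset.inE -(@mem_halves _ _ _ _ _ _ (val h)) //= imset_f.
Qed.

Lemma spin_contractE (F : {set edge G}) (S : spin G) (T : spin (contraction F)) :
  spin_contract S T <-> push (contr_of F) S T.
Proof.
have cE : cyc T = [set e | uncontract e \in cyc S] <->
    (forall h, (cH (contr_of F) h \in halves (cyc S)) = (h \in halves (cyc T))).
  split=> [-> h|E]; first by rewrite halves_uncontract contr_ofH.
  by apply: halves_inj; apply/setP => h; rewrite halves_uncontract -E contr_ofH.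
suff sE (q : contr (contraction (cyc S)) (contraction (cyc T)))
    (C : cvertex (cyc S)) (C' : cvertex (cyc T)) :
    (forall v, cV q (cproj (cyc S) v) = cproj (cyc T) (cV (contr_of F) v)) ->
    [exists v in val C, cproj (cyc T) (cproj F v) == C'] = (cV q C == C').
  split=> [[/cE c sg]|[c [q qV sg]]].
    have [q [qV _]] := quotient_contr c; split=> //; exists q => // C'.
    by rewrite sg; apply: eq_bigl => C; exact: sE.
  split; first exact/cE.
  by move=> C'; rewrite sg; apply: eq_bigl => C; rewrite (sE q _ _ qV).
move=> qV; apply/existsP/eqP => [[v /andP[]]|<-].
  by rewrite mem_cvertex => /eqP<- /eqP<-; rewrite qV contr_ofV.
have [v ->] := cprojP C; exists v; rewrite mem_cvertex eqxx /=.
by rewrite qV contr_ofV.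
Qed.

End PushCompatibility.

(** * Lifting spin structures and expanding graphs *)

(* A component of weight zero in G/P is a tree with even degrees, hence a point. *)
Lemma cyclic_wt0 (V H : finType) (n : nat) (G : graph V H n)
    (P : {set edge G}) u v : cyclic P ->
  wt (contraction P) (cproj P u) = 0%N -> cproj P u = cproj P v -> u = v.
Proof.
move=> cP w0 uv; apply/eqP; apply: contraT => nuv.
have deg2 w : w \in val (cproj P u) ->
    (2 <= #|[set h in halves P | endpt G h == w]|)%N.
  rewrite mem_cvertex => /eqP wu.
  have [w' ww' nw] : exists2 w', connect (adj P) w w' & w' != w.
    have [E|nE] := eqVneq u w; last by exists u; rewrite // -cproj_eq wu.
    by exists v; rewrite -?cproj_eq ?wu ?uv // -E eq_sym.
  have : (0 < #|[set h in halves P | endpt G h == w]|)%N.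
    case/connectP: ww' nw => -[|x p] /= => [_ ->|]; first by rewrite eqxx.
    case/andP => /hadjP[h [hP hw _]] _ _ _; apply/card_gt0P; exists h.
    by rewrite finset.inE hP hw eqxx.
  by have := cP w; case: #|_| => [|[]].
(* If the component has c vertices, [deg2] gives at least 2c half-edges of P in it; weight zero
   makes its [chi] equal to -2, which allows at most 2c - 2. *)
have := chi_contraction (cproj P u).
have : (\sum_(w in val (cproj P u)) 2 <=
    \sum_(w in val (cproj P u)) #|[set h in halves P | endpt G h == w]|)%N.
  exact: leq_sum.
rewrite sum_nat_const.
have -> : (\sum_(w in val (cproj P u)) #|[set h in halves P | endpt G h == w]| =
    #|halves (incident (cproj P u))|)%N.
  rewrite halves_incident -[RHS]sum1_card.
  rewrite [RHS](partition_big (endpt G) (mem (val (cproj P u)))) /=.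
    apply: eq_bigr => w wC; rewrite -sum1_card; apply: eq_bigl => h.
    rewrite !finset.inE; case: eqP => [->|]; rewrite ?andbF // !andbT.
    by rewrite -mem_cvertex wC andbT.
  by move=> h; rewrite finset.inE -mem_cvertex => /andP[].
rewrite {1}/chi w0 /chi sumrB sumr_const -mulr_natr.
rewrite -(big_morph Posz PoszD (erefl : Posz 0 = 0)) -big_distrr /=.
move: (\sum_(u | _) _)%N #|halves _| #|_| => a b c; lia.
Qed.

Section SingleEdge.
Context {V H V' H' : finType} {n : nat}.
Context {G : graph V H n} {G' : graph V' H' n} (m : contr G G') (a : H).
Hypothesis la : lost (cH m) = [set a; invol G a].

Local Notation u0 := (endpt G a).
Local Notation u1 := (endpt G (invol G a)).

Lemma one_edge_fibre u v : cV m u = cV m v -> u != v ->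
  (u = u0 /\ v = u1) \/ (u = u1 /\ v = u0).
Proof.
move=> /eqP; rewrite cV_conn la => /connectP[p]; elim: p u => [|w p IHp] u /=.
  by move=> _ ->; rewrite eqxx.
case/andP => /hadjP[h [+ <- <-]] pw E uv.
have : (endpt G (invol G h) = v) \/ (endpt G (invol G h) != v).
  by case: (eqVneq (endpt G (invol G h)) v); [left | right].
move: uv => /[swap]; rewrite !finset.inE => -[<-|nv].
  by move=> _ /orP[]/eqP->; rewrite ?involK; [left|right].
move=> uv; case: (IHp _ pw E nv) => -[E1 E2].
  by case/orP => /eqP hE; move: E1 uv; rewrite E2 hE ?involK ?eqxx // => <-; rewrite ?eqxx.
by case/orP => /eqP hE; move: E1 uv; rewrite E2 hE ?involK ?eqxx // => <-; rewrite ?eqxx.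
Qed.

Let cu : cV m u0 = cV m u1.
Proof.
by apply/eqP; rewrite cV_conn la; apply: connect1_half; rewrite !finset.inE eqxx.
Qed.

(* The contracted edge a is put into P when it is a loop, or when parity at its
   ends requires it. *)
Lemma cyclic_lift (P' : {set edge G'}) : cyclic P' ->
  exists P : {set edge G}, [/\ cyclic P,
    forall h', (cH m h' \in halves P) = (h' \in halves P') &
    (forall h, h \in lost (cH m) -> h \in halves P) \/ u0 <> u1].
Proof.
move=> cP'; pose K0 := cH m @: halves P'.
have eK0 : edgewise G K0.
  move=> _ /imsetP[h hP ->]; have [hi hN] := halves_edgewise hP.
  by rewrite cH_inv imset_f // (inj_eq (cH_inj (c := m))).
pose d v := #|[set h in K0 | endpt G h == v]|.
pose c := (u0 == u1) || odd (d u0).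
pose K := if c then lost (cH m) :|: K0 else K0.
have eK : edgewise G K.
  rewrite /K; case: (c) => // h; rewrite !finset.in_setU => /orP[hl|hK].
    by have [-> ->] := lost_edgewise hl.
  by have [-> ->] := eK0 _ hK; rewrite orbT.
have KP' h' : (cH m h' \in K) = (h' \in halves P').
  have K0P : (cH m h' \in K0) = (h' \in halves P').
    by rewrite mem_imset //; exact: cH_inj.
  rewrite /K; case: (c) => //.
  by rewrite finset.in_setU K0P (negPf (lost_im _ _)).
have aN : a != invol G a.
  have [|_] := @lost_edgewise _ _ _ _ _ _ _ m a; first by rewrite la !finset.inE eqxx.
  by rewrite eq_sym.
exists (edges_of G K); split; first last.
- rewrite halves_edges_of // /K /c; case: (u0 =P u1) => [_|]; last by right.
  by left=> h hl /=; rewrite finset.in_setU hl.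
- by move=> h'; rewrite halves_edges_of.
(* The half-edges of [K0] over v' correspond to those of P' at v', an even number. So [d] is even on
   one-point fibres, and has the same parity at u0 and u1 when these differ; inserting the
   contracted edge exactly when [d u0] is odd repairs both ends. *)
have evenT v' : ~~ odd (\sum_(v | cV m v == v') d v).
  rewrite (_ : (\sum_(v | _) _)%N = #|[set h in halves P' | endpt G' h == v']|) //.
  rewrite -(card_imset _ (cH_inj (c := m))) -sum1_card.
  rewrite [RHS](partition_big (endpt G) (fun v => cV m v == v')) /=; last first.
    by move=> _ /imsetP[h + ->]; rewrite finset.inE cV_end => /andP[].
  apply: eq_bigr => v vv'; rewrite /d -sum1_card; apply: eq_bigl => h.
  rewrite finset.inE; case: (endpt G h =P v) => [E|]; rewrite ?andbF // !andbT.
  apply/imsetP/imsetP => -[h' h'P hE]; exists h' => //; last first.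
    by move: h'P; rewrite finset.inE => /andP[].
  by rewrite finset.inE h'P -(cV_end m) -hE E vv'.
have dE v : #|[set h in K | endpt G h == v]| =
    ((if c then (u0 == v) + (u1 == v) else 0) + d v)%N.
  have lE : (#|[set h in lost (cH m) | endpt G h == v]| = (u0 == v) + (u1 == v))%N.
    rewrite la -sum1dep_card big_mkcondr big_setU1 ?finset.in_set1 //= big_set1.
    by do 2!case: (_ == v).
  rewrite /K; case: (c) => //; rewrite -lE.
  rewrite /d -cardsUI [X in (_ = _ + X)%N](_ : _ = 0)%N ?addn0.
    by apply: eq_card => h; rewrite !finset.inE -andb_orl.
  apply/eqP; rewrite cards_eq0; apply/eqP/setP => h; rewrite finset.in_set0.
  apply/negP => /finset.setIP[]; rewrite !finset.inE => /andP[hl _].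
  by case/andP => /imsetP[h' _ E]; rewrite E codom_f in hl.
move=> v; rewrite halves_edges_of // dE.
have single : (forall u, cV m u = cV m v -> u = v) -> ~~ odd (d v).
  move=> sv; have := evenT (cV m v); rewrite (big_pred1 v) // => u.
  by apply/eqP/eqP => [/sv|->].
have [E|N] := eqVneq u0 u1.
  have dv : ~~ odd (d v).
    apply: single => u uv; apply/eqP; apply: contraT => nuv.
    by case: (one_edge_fibre uv nuv) => -[E1 E2]; rewrite E1 E2 E eqxx in nuv.
  by rewrite /c E eqxx /= addnn oddD odd_double.
have d01 : ~~ odd (d u0 + d u1).
  have := evenT (cV m u0); rewrite (bigD1 u0) //= (big_pred1 u1) // => u /=.
  apply/andP/eqP => [[/eqP uu nu]|->]; last by rewrite cu eqxx eq_sym.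
  by case: (one_edge_fibre uu nu) => -[E1 E2] //; rewrite E2 eqxx in N.
have cE : c = odd (d u0) by rewrite /c (negPf N).
move: d01; rewrite cE !oddD; have [<-|nv0] := eqVneq u0 v.
  rewrite eq_sym (negPf N); by case: (odd (d u0)).
have [<-|nv1] := eqVneq u1 v.
  by case: (odd (d u0)); case: (odd (d u1)).
move=> _; rewrite if_same /=; apply: single => u uv.
apply/eqP; apply: contraT => /(one_edge_fibre uv) -[[_ E2]|[_ E2]].
  by rewrite E2 eqxx in nv1.
by rewrite E2 eqxx in nv0.
Qed.

(* The sign of a vertex C' of G'/P' is moved to a vertex of positive weight in its
   fibre. There is one if C' has positive weight: otherwise the fibre would be a
   single vertex of G/P carrying a as a loop, but a vertex of weight zero in G/P is
   a vertex of G, and a would have been put into P. *)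
Lemma push_lift (S' : spin G') : exists S, push m S S'.
Proof.
have [P [cP PP' PF]] := cyclic_lift (@cycP _ _ _ _ S').
have [q [qV qH]] := quotient_contr PP'.
have lift (C' : cvertex (cyc S')) : exists C, cV q C = C' /\
    (wt (contraction P) C = 0%N -> wt (contraction (cyc S')) C' = 0%N).
  apply: contrapT => nex.
  have wpos : wt (contraction (cyc S')) C' != 0%N.
    apply/eqP => w0; apply: nex; have [C E] := cV_surj q C'.
    by exists C; split.
  have w0 C : cV q C = C' -> wt (contraction P) C = 0%N.
    move=> E; apply/eqP; apply: contraT => wC; case: nex; exists C; split=> // w0.
    by rewrite w0 in wC.
  have [C CE] := cV_surj q C'.
  have := cV_chi q C'.
  rewrite (eq_bigr (fun=> - (2 : int))); last first.
    by move=> D /eqP DE; rewrite /chi w0.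
  rewrite sumr_const -(mulr_natr (- (2 : int))).
  set k := #|_|; set L := [set _ in _ | _].
  have kE : k = #|[set D | cV q D == C']| by rewrite cardsE; apply: eq_card.
  have k1 : (0 < k)%N.
    by rewrite kE; apply/card_gt0P; exists C; rewrite finset.inE CE.
  have Lsub h : h \in L -> val h \in lost (cH m).
    rewrite finset.inE => /andP[hl _]; apply: contraT => /lostP[h' E].
    have hP' : h' \notin halves (cyc S') by rewrite -PP' -E (valP h).
    move: hl; rewrite (_ : h = cH q (exist (fun x => x \notin halves (cyc S')) h' hP')).
      by rewrite (negPf (lost_im _ _)).
    by apply: val_inj; rewrite qH.
  have L2 : (#|L| <= 2)%N.
    rewrite -(card_imset _ val_inj); apply: leq_trans (_ : #|lost (cH m)| <= 2)%N.
      by apply/subset_leq_card/fintype.subsetP => _ /imsetP[h hL ->]; exact: Lsub.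
    by rewrite la cards2; case: (_ != _).
  (* Here [chi] at C' equals |L| - 2k, and positive weight makes it nonnegative. As |L| is at most
     2, this excludes k >= 2; it excludes k = 1 as soon as L is empty. *)
  have [k2|k2] := leqP 2 k.
    by rewrite /chi; move: wpos k2 L2; lia.
  have L0 : #|L| = 0%N.
    apply/eqP; rewrite cards_eq0; apply: contraT => /set0Pn[h hL].
    case: PF => [PF|uN]; first by have := valP h; rewrite PF ?Lsub.
    have qu0 : cV q (cproj P u0) = C'.
      have := Lsub _ hL; move: hL; rewrite finset.inE => /andP[_ /eqP<-].
      rewrite [endpt _ h]/(cproj P (endpt G (val h))) !qV la !finset.inE.
      by case/orP=> /eqP->; rewrite ?cu.
    have qu1 : cV q (cproj P u1) = C' by rewrite qV -cu -qV.
    case: uN; apply: (cyclic_wt0 cP); first exact: w0.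
    move: k2; rewrite ltnS kE => /card_le1_eqP; apply.
      by rewrite finset.inE qu1.
    by rewrite finset.inE qu0.
  by rewrite /chi; move: wpos k1; rewrite L0; lia.
have /choice[g gP] := lift.
unshelve eexists; first unshelve eapply (@Spin _ _ _ G P
   (fun C => if C == g (cV q C) then sgn S' (cV q C) else 0)).
- exact: cP.
- move=> C wC; case: eqP => // E; apply: sgnP.
  by have [_] := gP (cV q C); apply; rewrite -E.
split=> //; exists q => // C'; have [gE _] := gP C'.
rewrite (bigD1 (g C')) /= ?gE ?eqxx // big1 ?addr0 // => C /andP[/eqP-> nC].
by rewrite (negPf nC).
Qed.

End SingleEdge.

(** * Expanding a graph by one edge *)

Section AddEdge.
Context {V H W : finType} {n : nat} (G : graph V H n).
Context (p : W -> V) (e : H -> W) (a b : W) (w : W -> nat).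
Hypothesis pe : forall h, p (e h) = endpt G h.
Hypothesis psurj : forall v, exists u, p u = v.
Hypothesis pab : p a = p b.
Hypothesis pinj : forall u u', p u = p u' ->
  [\/ u = u', u = a /\ u' = b | u = b /\ u' = a].
Hypothesis pchi : forall v, chi G v =
  \sum_(u | p u == v) ((2 * w u)%:Z - 2) + (2 * (p a == v))%N%:Z.

Definition add_endpt (x : H + bool) : W :=
  match x with inl h => e h | inr c => if c then a else b end.

Definition add_invol (x : H + bool) : H + bool :=
  match x with inl h => inl (invol G h) | inr c => inr (~~ c) end.

Lemma add_gt0 : (0 < #|W|)%N. Proof. by apply/card_gt0P; exists a. Qed.

Lemma add_involK : involutive add_invol.
Proof. by case=> [h|c] /=; rewrite ?involK ?negbK. Qed.

Lemma add_leg_inj : injective (fun i => inl bool (leg G i)).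
Proof. by move=> i j [] /leg_inj. Qed.

Lemma add_legP x : add_invol x = x <-> exists i, x = inl bool (leg G i).
Proof.
case: x => [h|c] /=; last by split=> [[]|[i]] //; case: c.
split=> [[]/legP[i ->]|[i [->]]]; first by exists i.
by congr inl; apply/legP; exists i.
Qed.

(** The two halves of the new edge are [inr true] at a and [inr false] at b. Equal a and b give a
    loop, distinct ones a splitting of a vertex; in both cases p contracts the new edge, and [pchi]
    attributes its two halves to the vertex p a. *)
Definition add_edge : graph W (H + bool)%type n :=
  Graph w add_endpt add_gt0 add_involK add_leg_inj add_legP.

Lemma lost_inl : lost (@inl H bool) = [set inr true; inr false].
Proof.
apply/setP => -[h|c]; rewrite !finset.inE.
  by rewrite codom_f.
apply/idP/orP => [_|_]; first by case: c; [left|right].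
by apply/codomP => -[].
Qed.

Lemma add_edge_contr : exists m : contr add_edge G,
  lost (cH m) = [set inr true; invol add_edge (inr true)].
Proof.
have conn_ab u u' : [\/ u = u', u = a /\ u' = b | u = b /\ u' = a] ->
    connect (hadj add_edge (lost inl)) u u'.
  case=> [->|[-> ->]|[-> ->]]; first exact: connect0.
  - have := @connect1_half _ _ _ add_edge (lost inl) (inr true); apply.
    by rewrite lost_inl !finset.inE eqxx.
  - have := @connect1_half _ _ _ add_edge (lost inl) (inr false); apply.
    by rewrite lost_inl !finset.inE eqxx orbT.
unshelve eexists; first unshelve eapply (@Contr _ _ _ _ _ add_edge G p inl).
- by move=> x y [].
- by [].
- by [].
- by [].
- exact: psurj.
- move=> u v; apply/eqP/idP => [/pinj/conn_ab //|/connectP[q]].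
  elim: q u => [|x q IHq] u /= => [_ -> //|/andP[/hadjP[h [+ <- <-]] pq E]].
  rewrite lost_inl !finset.inE => /orP[]/eqP hE; rewrite -(IHq _ pq E) hE //=.
- move=> v; rewrite pchi; congr (_ + Posz _).
  rewrite lost_inl -sum1dep_card big_mkcondr big_setU1 ?finset.in_set1 //= big_set1 /=.
  by rewrite -pab; case: (_ == v).
by rewrite lost_inl.
Qed.

Lemma add_edge_valence u : valence add_edge u =
  (#|[set h | e h == u]| + (a == u) + (b == u))%N.
Proof.
rewrite /valence -!sum1dep_card big_mkcond big_sumType /= big_bool /=.
by rewrite -big_mkcond addnA; do 2!case: (_ == u).
Qed.

Lemma add_edge_stable : connected_graph G ->
  (forall u, 0 < (2 * w u)%:Z - 2 +
     (#|[set h | e h == u]| + (a == u) + (b == u))%N%:Z) ->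
  exists m : contr add_edge G, stable add_edge /\
    lost (cH m) = [set inr true; invol add_edge (inr true)].
Proof.
move=> con st; have [m mE] := add_edge_contr; exists m; split=> //.
apply/stableP; split; first exact/(contr_connected m).
by move=> u; rewrite add_edge_valence; exact: st.
Qed.

End AddEdge.

Lemma sumz_const (T : finType) (c : int) : \sum_(x : T) c = c * #|T|%:Z.
Proof. by rewrite sumr_const -(mulr_natr c) natz. Qed.

Section Expansion.
Context {V H : finType} {n : nat} (G : graph V H n).

(** Each term of [sum_chi_valence] is one, so |V| = 2g - 2 + n. Counting half-edges gives 3|V| =
    2|E| + n, whence |E| = 3g - 3 + n. *)
Lemma trivalent_edges : connected_graph G ->
  (forall v, wt G v = 0%N /\ valence G v = 3) ->
  (#|edge G| + 3 = 3 * genus G + n)%N.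
Proof.
move=> con tri.
have := sum_chi_valence con; have := card_half_leg G.
have := sum_valence G id predT; rewrite /=.
rewrite (eq_bigr (fun=> 3 : int)) => [|v _]; last by case: (tri v) => _ ->.
rewrite [X in _ = _ -> _ -> X = _ -> _](eq_bigr (fun=> 1 : int)) => [|v _]; last first.
  by case: (tri v) => w0 ->; rewrite /chi w0.
rewrite !sumz_const (_ : #|[set _ | _]| = #|H|); last first.
  by apply: eq_card => h; rewrite finset.inE.
move: #|V| #|H| #|edge G| => x y z; lia.
Qed.

(* Either a vertex of positive weight trades one unit of weight for a loop, or a
   weightless vertex of valence at least four is split in two. *)
Lemma expansion : stable G -> (#|edge G| + 3 != 3 * genus G + n)%N ->
  exists (W H' : finType) (G' : graph W H' n) (m : contr G' G) (x : H'),
    stable G' /\ lost (cH m) = [set x; invol G' x].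
Proof.
move=> /stableP[con st] nE.
have [v0 v0P] : exists v0, wt G v0 != 0%N \/ (wt G v0 = 0%N /\ valence G v0 != 3).
  apply: contrapT => nex; move/eqP: nE; apply; apply: trivalent_edges con _ => v.
  split; first by apply/eqP; apply: contraT => w0; case: nex; exists v; left.
  apply/eqP; apply: contraT => v3; case: nex; exists v.
  by have [w0|w0] := eqVneq (wt G v) 0%N; [right | left].
case: v0P => [w0|[w0 val3]].
  (* A loop at v0 adds two to the valence and the lost unit of weight takes two off [chi], so the
     stability inequalities are unchanged. *)
  have [||||||u|m [sm mE]] := @add_edge_stable _ _ V n G id (endpt G) v0 v0
     (fun u => wt G u - (v0 == u))%N; rewrite /=; last first.
  - by exists V, (H + bool)%type; eexists; exists m; eexists; split; [exact: sm | exact: mE].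
  - by have := st u; rewrite /chi /valence; case: eqP => [<-|_]; move: w0; lia.
  - exact: con.
  - move=> v; rewrite (big_pred1 v) // /chi; case: eqP => [<-|_]; move: w0; lia.
  - by move=> u u' ->; constructor 1.
  - by [].
  - by move=> v; exists v.
  - by [].
(* Stability in weight zero gives valence at least three, hence at least four here. The half-edges
   h1 and h2 move to the new vertex, which becomes trivalent with the new edge; v0 keeps at least
   two half-edges besides its end of the new edge. *)
have /card_gt1P[h1 [h2 [h1v h2v h12]]] : (1 < #|[set h | endpt G h == v0]|)%N.
  by have := st v0; rewrite /chi w0 /valence; lia.
have val4 : (3 < valence G v0)%N by have := st v0; rewrite /chi w0; lia.
pose p (x : V + unit) := if x is inl v then v else v0.
pose e h : V + unit := if (h == h1) || (h == h2) then inr tt else inl (endpt G h).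
pose w (x : V + unit) := if x is inl v then wt G v else 0%N.
move: h1v h2v; rewrite !finset.inE => /eqP h1v /eqP h2v.
have [||||||u|m [sm mE]] := @add_edge_stable _ _ (V + unit)%type n G p e (inr tt) (inl v0) w;
    last first.
- by exists (V + unit)%type, (H + bool)%type; eexists; exists m; eexists; split;
    [exact: sm | exact: mE].
- case: u => [v|[]] /=; rewrite ?eqxx.
    have [vE|nv] := eqVneq v v0; last first.
      have -> : #|[set h | e h == inl v]| = valence G v.
        apply: eq_card => h; rewrite !finset.inE /e.
        case: (h =P h1) => [->|_] /=; first by rewrite h1v [v0 == v]eq_sym (negPf nv).
        by case: (h =P h2) => [->|_] //=; rewrite h2v [v0 == v]eq_sym (negPf nv).
      by have := st v; rewrite /chi; lia.
    have : (valence G v0 = #|[set h | e h == inl v]| + 2)%N.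
      rewrite vE /valence -(cardsID [set h1; h2]) addnC; congr (_ + _)%N.
        apply: eq_card => h; rewrite !finset.inE /e.
        by case: (_ || _) => //=; rewrite (inj_eq inl_inj).
      have <- : #|[set h1; h2]| = 2%N by rewrite cards2 h12.
      apply: eq_card => h; rewrite !finset.inE andb_idl //.
      by case/orP => /eqP->; rewrite ?h1v ?h2v eqxx.
    by move=> val2; move: val4; rewrite val2 vE eqxx w0; move: #|_| => k; lia.
  have -> : #|[set h | e h == inr tt]| = 2%N.
    have <- : #|[set h1; h2]| = 2%N by rewrite cards2 h12.
    by apply: eq_card => h; rewrite !finset.inE /e; case: ifP.
  by [].
- exact: con.
- move=> v; rewrite big_mkcond big_sumType /= -big_mkcond /=.
  rewrite (big_pred1 v) // (bigD1 tt) //= big1; last by case.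
  by rewrite /chi; case: eqP => _; lia.
- case=> [v|[]] [v'|[]] /=.
  + by move=> ->; constructor 1.
  + by move=> ->; constructor 3.
  + by move=> <-; constructor 2.
  + by constructor 1.
- by [].
- by move=> v; exists (inl v).
- move=> h; rewrite /e; case: (h =P h1) => [->|_] /=; first by rewrite h1v.
  by case: (h =P h2) => [->|_] //=; rewrite h2v.
Qed.

End Expansion.

(** * Cones and arrows *)

Section Cones.
Context {R : realType}.

Lemma coord_ge0 (I : finType) (x : cone R I) i : (0 <= coord x i)%E.
Proof. by have := set_mem (valP x); exact. Qed.

Lemma cone_ext (I : finType) (x y : cone R I) :
  (forall i, coord x i = coord y i) -> x = y.
Proof. by move=> E; apply: val_inj; apply/funext => i; exact: E. Qed.

Definition mk_cone (I : finType) (f : I -> \bar R) (f0 : forall i, (0 <= f i)%E) :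
  cone R I := exist _ (f : {ptws I -> \bar R}) (mem_set f0).

Lemma mk_coneE (I : finType) (f : I -> \bar R) f0 i : coord (@mk_cone I f f0) i = f i.
Proof. by []. Qed.

Lemma monomial_linear (I J : finType) (f : cone R I -> cone R J) :
  (forall j, (exists c : int, exists i, forall x,
       coord (f x) j = ((c%:~R)%:E * coord x i)%E) \/
     (forall x, coord (f x) j = 0%E)) -> integral_linear f.
Proof.
move=> fE; have /choice[A AP] : forall j, exists a : I -> int, forall x,
    coord (f x) j = (\sum_(i : I) ((a i)%:~R)%:E * coord x i)%E.
  move=> j; case: (fE j) => [[c [i E]]|E].
    exists (fun k => if k == i then c else 0) => x.
    rewrite (bigD1 i) //= eqxx E big1 ?adde0 // => k /negPf->.
    by rewrite mul0e.
  by exists (fun=> 0) => x; rewrite E big1 // => i _; rewrite mul0e.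
by exists A => x j; exact: AP.
Qed.

End Cones.

Section HalfCoord.
Context {R : realType} {V H : finType} {n : nat} {G : graph V H n}.
Implicit Types x y : cone R (edge G).

(* The coordinate at the edge containing h; legs get 0. *)
Definition hcoord x (h : H) : \bar R :=
  if [pick e : edge G | h \in val e] is Some e then coord x e else 0%E.

Lemma hcoordE x (e : edge G) h : h \in val e -> hcoord x h = coord x e.
Proof.
move=> he; rewrite /hcoord; case: pickP => [e' he'|/(_ e)]; last by rewrite he.
by rewrite (edge_eq he he').
Qed.

Lemma hcoord_leg x h : invol G h = h -> hcoord x h = 0%E.
Proof.
move=> hh; rewrite /hcoord; case: pickP => // e /edge_halfE[_].
by rewrite hh eqxx.
Qed.

Lemma hcoord_ge0 x h : (0 <= hcoord x h)%E.
Proof. by rewrite /hcoord; case: pickP => // e _; exact: coord_ge0. Qed.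

Lemma hcoord_invol x h : hcoord x (invol G h) = hcoord x h.
Proof.
have [hh|/half_edge[e he]] := eqVneq (invol G h) h; first by rewrite hh.
by rewrite !(@hcoordE x e) ?invol_edge.
Qed.

Lemma hcoord_ext x y : (forall h, hcoord x h = hcoord y h) -> x = y.
Proof.
move=> E; apply: cone_ext => e; have [h he] := edge_half e.
by rewrite -!(hcoordE _ he).
Qed.

Lemma hcoord_mk (f : H -> \bar R) (f0 : forall h, (0 <= f h)%E) :
  (forall h, f (invol G h) = f h) ->
  exists x, forall h, hcoord x h = if invol G h == h then 0%E else f h.
Proof.
move=> fi; have /choice[s sP] : forall e : edge G, exists h, h \in val e.
  exact: edge_half.
exists (@mk_cone R _ (fun e => f (s e)) (fun e => f0 (s e))) => h.
have [hh|/half_edge[e he]] := eqVneq; first exact: hcoord_leg.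
rewrite (hcoordE _ he) mk_coneE; have [E _] := edge_halfE (sP e).
by move: he; rewrite E !finset.inE => /orP[]/eqP->; rewrite ?fi.
Qed.

Definition positive x := forall e, coord x e <> 0%E.

Lemma positiveP x : positive x -> forall h, invol G h != h -> hcoord x h <> 0%E.
Proof. by move=> px h /half_edge[e he]; rewrite (hcoordE _ he). Qed.

End HalfCoord.

Section Inclusion.
Context {R : realType} {V H V' H' : finType} {n : nat}.
Context {G : graph V H n} {G' : graph V' H' n}.

Definition incl (m : contr G G') (f : cone R (edge G') -> cone R (edge G)) :=
  forall x, (forall h, hcoord (f x) (cH m h) = hcoord x h) /\
            (forall h, h \in lost (cH m) -> hcoord (f x) h = 0%E).

Lemma contr_leg (m : contr G G') h :
  (invol G (cH m h) == cH m h) = (invol G' h == h).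
Proof. by rewrite cH_inv (inj_eq (cH_inj (c := m))). Qed.

Lemma extend_cone (m : contr G G') (x : cone R (edge G')) :
  exists y : cone R (edge G), (forall h, hcoord y (cH m h) = hcoord x h) /\
            (forall h, h \in lost (cH m) -> hcoord y h = 0%E).
Proof.
pose f h : \bar R := if [pick h' | cH m h' == h] is Some h' then hcoord x h' else 0%E.
have fE h : f (cH m h) = hcoord x h.
  rewrite /f; case: pickP => [h' /eqP/cH_inj->//|/(_ h)]; by rewrite eqxx.
have f0 h : h \in lost (cH m) -> f h = 0%E.
  by rewrite /f; case: pickP => // h' /eqP<-; rewrite (negPf (lost_im _ _)).
have fge h : (0 <= f h)%E by rewrite /f; case: pickP => // h' _; exact: hcoord_ge0.
have [|y yE] := @hcoord_mk R _ _ _ G f fge.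
  move=> h; have [hl|/lostP[h' ->]] := boolP (h \in lost (cH m)).
    by have [il _] := lost_edgewise hl; rewrite !f0.
  by rewrite cH_inv !fE hcoord_invol.
exists y; split=> h; rewrite yE.
  by rewrite contr_leg fE; case: eqP => // /hcoord_leg->.
by move=> hl; rewrite f0 // if_same.
Qed.

Lemma restrict_cone (m : contr G G') (y : cone R (edge G)) :
  exists x : cone R (edge G'), forall h, hcoord x h = hcoord y (cH m h).
Proof.
have [|x xE] := @hcoord_mk R _ _ _ G' (fun h => hcoord y (cH m h))
    (fun h => hcoord_ge0 _ _).
  by move=> h; rewrite -cH_inv hcoord_invol.
exists x => h; rewrite xE; case: eqP => // hh.
by rewrite hcoord_leg // cH_inv hh.
Qed.

Lemma incl_exists (m : contr G G') : exists f, incl m f.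
Proof. by have /choice[f fP] := extend_cone m; exists f. Qed.

Lemma inclP (m : contr G G') f x y : incl m f ->
  (f x = y <-> (forall h, hcoord y (cH m h) = hcoord x h) /\
               (forall h, h \in lost (cH m) -> hcoord y h = 0%E)).
Proof.
move=> mf; split=> [<-|[E1 E2]]; first exact: mf.
apply: hcoord_ext => h; have [F1 F2] := mf x.
have [hl|/lostP[h' ->]] := boolP (h \in lost (cH m)); first by rewrite F2 ?E2.
by rewrite F1 E1.
Qed.

Lemma cH_edge (m : contr G G') (e' : edge G') : exists e : edge G,
  forall h, (cH m h \in val e) = (h \in val e').
Proof.
have [h he'] := edge_half e'; have [E hN] := edge_halfE he'.
have [|e he] := @half_edge _ _ _ G (cH m h); first by rewrite contr_leg.
exists e => k; have [-> _] := edge_halfE he; rewrite E !finset.inE cH_inv.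
by rewrite !(inj_eq (cH_inj (c := m))).
Qed.

Lemma edge_cases (m : contr G G') (e : edge G) :
  (exists e' : edge G', forall h, (cH m h \in val e) = (h \in val e')) \/
  (forall h, h \in val e -> h \in lost (cH m)).
Proof.
have [h he] := edge_half e; have [E hN] := edge_halfE he.
have [hl|/lostP[k hE]] := boolP (h \in lost (cH m)).
  right=> x; rewrite E => /finset.set2P[]-> //.
  by case: (lost_edgewise hl).
left; have [|e' ke'] := @half_edge _ _ _ G' k; first by rewrite -(contr_leg m) -hE.
exists e'; have [e1 e1P] := cH_edge m e'; suff -> : e = e1 by [].
by apply: (edge_eq he); rewrite hE e1P.
Qed.

Local Open Scope classical_set_scope.

Lemma incl_face_morphism (m : contr G G') f : incl m f -> face_morphism f.
Proof.
move=> mf; split.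
- apply: monomial_linear => e; have [[e' ee']|el] := edge_cases m e; last first.
    by right=> x; have [h he] := edge_half e; rewrite -(hcoordE _ he) (mf x).2 ?el.
  left; exists 1, e' => x; have [h he'] := edge_half e'.
  have he := he'; rewrite -ee' in he.
  by rewrite -(hcoordE _ he) -(hcoordE _ he') (mf x).1 mul1e.
- exists [set e : edge G | val e \subset lost (cH m)]%SET.
  apply/seteqP; split=> [_ [x _ <-] e /=|y /= y0].
    rewrite finset.inE => /fintype.subsetP el; have [h he] := edge_half e.
    by rewrite -(hcoordE _ he) (mf x).2 ?el.
  have [x xE] := restrict_cone m y; exists x => //.
  apply/(inclP _ _ mf); split=> [h|h hl]; first by rewrite xE.
  have [hi hN] := lost_edgewise hl; have [e he] := half_edge hN.
  rewrite (hcoordE _ he); apply: y0; rewrite finset.inE.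
  have [-> _] := edge_halfE he.
  by rewrite finset.subUset !finset.sub1set hl hi.
have /choice[r rE] := restrict_cone m.
exists r; last by move=> x; apply: hcoord_ext => h; rewrite rE (mf x).1.
apply: monomial_linear => e'; left; have [e ee'] := cH_edge m e'.
exists 1, e => y; have [h he'] := edge_half e'.
have he := he'; rewrite -ee' in he.
by rewrite -(hcoordE _ he) -(hcoordE _ he') rE mul1e.
Qed.

(** The point with all coordinates equal to 1 is not on the face where the coordinate of h
    vanishes. *)
Lemma incl_range (m : contr G G') (f : cone R (edge G') -> cone R (edge G)) h :
  incl m f -> h \in lost (cH m) -> range f <> setT.
Proof.
move=> mf hl E.
have [|y yE] := @hcoord_mk R _ _ _ G (fun=> 1%E) (fun=> @lee01 R); first by [].
have : range f y by rewrite E.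
case=> x _ xy; have := yE h; rewrite -xy (mf x).2 //.
case: (lost_edgewise hl) => _ /negPf-> [] /eqP.
by rewrite eq_sym oner_eq0.
Qed.

End Inclusion.

Lemma lost_contr_of_iso (V H V' H' : finType) (n : nat) (G : graph V H n)
    (F : {set edge G}) (G' : graph V' H' n) (a : iso (contraction F) G') :
  lost (cH (contr_comp (contr_of F) (contr_iso a))) = halves F.
Proof.
rewrite (_ : cH _ = cH (contr_of F) \o cH (contr_iso a)); last first.
  by apply/funext => h; exact: contr_compH.
rewrite lost_comp lost_contr_of lost_contr_iso.
by rewrite imset0 finset.setU0.
Qed.

Lemma face_inclusionE (R : realType) (V H V' H' : finType) (n : nat)
    (G : graph V H n) (F : {set edge G}) (G' : graph V' H' n)
    (a : iso (contraction F) G') (f : cone R (edge G') -> cone R (edge G)) :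
  face_inclusion a f <-> incl (contr_comp (contr_of F) (contr_iso a)) f.
Proof.
set m := contr_comp _ _.
have lm : lost (cH m) = halves F by exact: lost_contr_of_iso.
have mE h : cH m h = val (cH (contr_iso a) h) by rewrite contr_compH contr_ofH.
have ainj := bij_inj (isoH_bij a).
split=> fP x; have [f0 fx] := fP x; split.
- move=> h; have [hh|hN] := eqVneq (invol G' h) h.
    by rewrite !hcoord_leg // -?mE; apply/eqP; rewrite (contr_leg m) hh.
  have [|e he] := @half_edge _ _ _ (contraction F) (cH (contr_iso a) h).
    by rewrite (contr_leg (contr_iso a)).
  rewrite mE (@hcoordE _ _ _ _ _ _ (uncontract e)) /= ?imset_f // fx.
  apply/esym/hcoordE.
  by rewrite /= -{1}[h](contr_isoH a) imset_f.
- by rewrite lm => h /halvesP[e eF he]; rewrite (hcoordE _ he) f0.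
- move=> e eF; have [h he] := edge_half e; rewrite -(hcoordE _ he) fx // lm.
  by rewrite (mem_halves _ he).
- move=> e; have [h he] := edge_half e.
  rewrite -(@hcoordE _ _ _ _ _ _ (uncontract e) (val h)) /= ?imset_f //.
  rewrite -(@hcoordE _ _ _ _ _ _ (iso_edge a e) (isoH a h)) /= ?imset_f //.
  by rewrite -f0 mE; congr (hcoord _ (val _)); apply: ainj; rewrite contr_isoH.
Qed.

Section ContrEq.
Context {V H V' H' : finType} {n : nat}.
Context {G : graph V H n} {G' : graph V' H' n}.

Lemma incl_eq (R : realType) (m1 m2 : contr G G')
    (f : cone R (edge G') -> cone R (edge G)) :
  (forall h, cH m1 h = cH m2 h) -> incl m1 f -> incl m2 f.
Proof. by move=> /funext E; rewrite /incl E. Qed.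

Lemma push_eq (m1 m2 : contr G G') S S' :
  (forall v, cV m1 v = cV m2 v) -> (forall h, cH m1 h = cH m2 h) ->
  push m1 S S' -> push m2 S S'.
Proof. by move=> /funext EV /funext EH; rewrite /push EV EH. Qed.

Lemma factor_lost (V1 H1 : finType) (G1 : graph V1 H1 n) (m1 : contr G G1)
    (m2 : contr G G') (m : contr G1 G') :
  (forall h, cH m1 (cH m h) = cH m2 h) -> lost (cH m2) \subset lost (cH m1) ->
  lost (cH m) = finset.set0.
Proof.
move=> mH /fintype.subsetP sub; apply: lost0 => h.
have /lostP[h' E] : cH m1 h \notin lost (cH m2).
  by apply/negP => /sub; rewrite (negPf (lost_im _ _)).
by exists h'; apply: (cH_inj (c := m1)); rewrite mH.
Qed.

(** Brings an abstract contraction back to the shape in which the diagrams define their arrows. *)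
Lemma contr_to_iso (m : contr G G') :
  exists (F : {set edge G}) (a : iso (contraction F) G'),
    (forall v, cV (contr_comp (contr_of F) (contr_iso a)) v = cV m v) /\
    (forall h, cH (contr_comp (contr_of F) (contr_iso a)) h = cH m h).
Proof.
pose F := edges_of G (lost (cH m)).
have lF : lost (cH (contr_of F)) = lost (cH m).
  by rewrite lost_contr_of halves_edges_of //; exact: lost_edgewise.
have [|m1 [m1V m1H]] := @contr_factor _ _ _ _ _ _ _ _ _ _ (contr_of F) m.
  by rewrite lF.
have [|a [aV aH]] := @iso_of_contr _ _ _ _ _ _ _ m1.
  by apply: factor_lost m1H _; rewrite lF.
exists F, a; split=> [v|h].
  by rewrite contr_compV contr_isoV aV.
rewrite contr_compH -m1H; congr (cH _ _).
by apply: (bij_inj (isoH_bij a)); rewrite contr_isoH aH.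
Qed.

End ContrEq.

(** * Relabelling graphs by ordinals *)

Section Ordinalize.
Context {V H : finType} {n : nat} (G : graph V H n).

Let owt (v : 'I_#|V|) := wt G (enum_val v).
Let oendpt (h : 'I_#|H|) := enum_rank (endpt G (enum_val h)).
Let oinvol (h : 'I_#|H|) := enum_rank (invol G (enum_val h)).
Let oleg i := enum_rank (leg G i).

Lemma ord_vertex : (0 < #|'I_#|V| |)%N.
Proof. by rewrite card_ord; exact: (graph_vertex G). Qed.

Lemma ord_involK : involutive oinvol.
Proof. by move=> h; rewrite /oinvol enum_rankK involK enum_valK. Qed.

Lemma ord_leg_inj : injective oleg.
Proof. by move=> i j /enum_rank_inj /leg_inj. Qed.

Lemma ord_legP h : oinvol h = h <-> exists i, h = oleg i.
Proof.
rewrite /oinvol /oleg; split=> [E|[i ->]].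
  have [|i hi] := (legP G (enum_val h)).1; first by rewrite -{2}E enum_rankK.
  by exists i; rewrite -hi enum_valK.
by rewrite enum_rankK; congr enum_rank; apply/legP; exists i.
Qed.

Definition ord_graph : graph 'I_#|V| 'I_#|H| n :=
  @Graph _ _ n owt oendpt oinvol oleg ord_vertex ord_involK ord_leg_inj ord_legP.

Lemma ord_iso : inhabited (iso G ord_graph).
Proof.
split; apply: (@Iso _ _ _ _ _ G ord_graph enum_rank enum_rank).
- exact: enum_rank_bij.
- exact: enum_rank_bij.
- by move=> h; rewrite /= /oendpt enum_rankK.
- by move=> h; rewrite /= /oinvol enum_rankK.
- by move=> v; rewrite /= /owt enum_rankK.
- by [].
Qed.

(** Contractions live on subtypes and expansions on sum types, whereas objects of the diagrams have
    ordinals as vertices and half-edges. *)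
Lemma stable_obj (g : nat) : stable G -> genus G = g ->
  exists (X : stable_graph g n) (m : contr G X), lost (cH m) = finset.set0.
Proof.
move=> sG gG; have [a] := ord_iso.
have sO : stable ord_graph := contr_stable (contr_iso a) sG.
have gO : genus ord_graph = g by rewrite (contr_genus (contr_iso a)) ?gG //; case: sG.
by exists (StableGraph sO gO), (contr_iso a); exact: lost_contr_iso.
Qed.

End Ordinalize.

Section Arrows.
Context {R : realType} {g n : nat}.

Lemma curve_arrP (X' X : stable_graph g n) (f : cone R (edge X') -> cone R (edge X)) :
  @arr R (curve_complex R g n) X' X f <-> exists m : contr X X', incl m f.
Proof.
split=> [[F [a /face_inclusionE i]]|[m i]].
  by exists (contr_comp (contr_of F) (contr_iso a)).
have [F [a [_ aH]]] := contr_to_iso m; exists F, a.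
by apply/face_inclusionE; apply: incl_eq i => h.
Qed.

Lemma spin_arrP (S' S : stable_spin_graph g n)
    (f : cone R (edge (spgraph S')) -> cone R (edge (spgraph S))) :
  @arr R (spin_complex R g n) S' S f <->
  exists m : contr (spgraph S) (spgraph S'),
    push m (spspin S) (spspin S') /\ incl m f.
Proof.
split=> [[F [a [T [/spin_contractE c /spin_isoE i /face_inclusionE fi]]]]|[m [p i]]].
  exists (contr_comp (contr_of F) (contr_iso a)); split=> //.
  by apply: push_trans c i => [v|h]; rewrite ?contr_compV ?contr_compH.
have [F [a [aV aH]]] := contr_to_iso m.
have [T c] := push_exists (contr_of F) (spspin S).
exists F, a, T; split; first exact/spin_contractE.
  apply/spin_isoE; apply: push_factor c p => [v|h].
    by rewrite -aV contr_compV.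
  by rewrite -aH contr_compH.
by apply/face_inclusionE; apply: incl_eq i => h.
Qed.

Lemma incl_comp (V H V1 H1 V2 H2 : finType) (G : graph V H n)
    (G1 : graph V1 H1 n) (G2 : graph V2 H2 n) (m1 : contr G G1) (m2 : contr G1 G2)
    (f1 : cone R (edge G1) -> cone R (edge G)) (f2 : cone R (edge G2) -> cone R (edge G1)) :
  incl m1 f1 -> incl m2 f2 -> incl (contr_comp m1 m2) (f1 \o f2).
Proof.
move=> i1 i2 x; split=> h /=.
  by rewrite contr_compH (i1 _).1 (i2 _).1.
rewrite (_ : cH _ = cH m1 \o cH m2); last by apply/funext => k; exact: contr_compH.
rewrite lost_comp => /finset.setUP[/(i1 _).2//|/imsetP[k kl ->]].
by rewrite (i1 _).1 (i2 _).2.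
Qed.

Lemma incl_id (V H : finType) (G : graph V H n) :
  incl (contr_id G) (id : cone R (edge G) -> cone R (edge G)).
Proof.
move=> x; split=> h; first by rewrite contr_idH.
by rewrite lost0 ?finset.in_set0 // => k; exists k; rewrite contr_idH.
Qed.

(* Since x is positive, m1 contracts exactly the edges of length zero of the common
   point, hence factors through m2. *)
Lemma incl_factor (V H V1 H1 V2 H2 : finType) (G : graph V H n)
    (G1 : graph V1 H1 n) (G2 : graph V2 H2 n) (m1 : contr G G1) (m2 : contr G G2)
    (f1 : cone R (edge G1) -> cone R (edge G)) (f2 : cone R (edge G2) -> cone R (edge G)) x y :
  incl m1 f1 -> incl m2 f2 -> f1 x = f2 y -> positive x ->
  exists (m : contr G2 G1) (f : cone R (edge G1) -> cone R (edge G2)),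
    [/\ forall v, cV m (cV m2 v) = cV m1 v, forall h, cH m2 (cH m h) = cH m1 h,
        incl m f & f x = y].
Proof.
move=> i1 i2 E px.
have [|m [mV mH]] := @contr_factor _ _ _ _ _ _ _ _ _ _ m2 m1.
  apply/fintype.subsetP => h hl; have := (i2 y).2 h hl; rewrite -E => h0.
  apply: contraT => /lostP[k hk]; move: h0; rewrite hk (i1 x).1.
  have [kk|kN] := eqVneq (invol G1 k) k; last by move/(positiveP px kN).
  by case: (lost_edgewise hl) => _; rewrite hk (contr_leg m1) kk eqxx.
have [f fi] := @incl_exists R _ _ _ _ _ _ _ m.
exists m, f; split=> //; apply/(inclP _ _ fi); split=> [h|h hl].
  by rewrite -(i2 y).1 mH -E (i1 x).1.
rewrite -(i2 y).1 -E (i1 x).2 //; apply: contraT => /lostP[k].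
by rewrite -mH => /cH_inj hk; rewrite hk (negPf (lost_im _ _)) in hl.
Qed.

Lemma positive_reduction (X : stable_graph g n) (x : cone R (edge X)) :
  exists (X' : stable_graph g n) (m : contr X X')
    (f : cone R (edge X') -> cone R (edge X)) x',
    [/\ incl m f, f x' = x & positive x'].
Proof.
pose F := [set e : edge X | coord x e == 0%E].
have sF : stable (contraction F) := contr_stable (contr_of F) (sgraph_stable X).
have gF : genus (contraction F) = g.
  by rewrite (contr_genus (contr_of F)) ?sgraph_genus //; case: (sgraph_stable X).
have [X' [m' l0]] := stable_obj sF gF.
pose m := contr_comp (contr_of F) m'.
have lm : lost (cH m) = halves F.
  rewrite (_ : cH _ = cH (contr_of F) \o cH m'); last by apply/funext => k; exact: contr_compH.
  by rewrite lost_comp l0 imset0 finset.setU0 lost_contr_of.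
have [f fi] := @incl_exists R _ _ _ _ _ _ _ m.
have [x' xE] := restrict_cone m x.
exists X', m, f, x'; split=> //.
  apply/(inclP _ _ fi); split=> [h|h]; first by rewrite xE.
  by rewrite lm => /halvesP[e]; rewrite finset.inE => /eqP e0 /(hcoordE x)->.
move=> e e0; have [e1 e1P] := cH_edge m e; have [h he] := edge_half e.
have := lost_im (cH m) h; rewrite lm => /negP; apply; apply/halvesP.
exists e1; last by rewrite e1P.
rewrite finset.inE -(@hcoordE _ _ _ _ _ x e1 (cH m h)) ?e1P //.
by rewrite -xE (hcoordE _ he) e0.
Qed.

End Arrows.

(** * Colimits in which every point has a positive representative *)

Section Diagram.
Context {R : realType} (D : cone_diagram R).
Variable pos : forall a : obj D, cone R (ray a) -> Prop.
Hypothesis arr_id : forall a, @arr R D a a id.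
Hypothesis arr_comp : forall a b c f f',
  @arr R D a b f -> @arr R D b c f' -> @arr R D a c (f' \o f).
Hypothesis arr_factor : forall a b c f f' x y, @arr R D a c f -> @arr R D b c f' ->
  f x = f' y -> pos x -> exists2 k, @arr R D a b k & k x = y.
Hypothesis arr_pos : forall a x, exists (b : obj D) f x',
  [/\ @arr R D b a f, f x' = x & pos x'].

Lemma cone_pt_eqP a b (x : cone R (@ray R D a)) (y : cone R (@ray R D b)) :
  cone_pt x = cone_pt y <->
  clos_refl_sym_trans (cone_union D) (@gluing R D) (existT _ a x) (existT _ b y).
Proof. by split=> [/eqmodP/asboolP|E]; [|apply/eqmodP/asboolP]. Qed.

Lemma cone_pt_arr a b f (x : cone R (@ray R D a)) :
  @arr R D a b f -> cone_pt x = cone_pt (f x).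
Proof. by move=> ff; apply/cone_pt_eqP; apply: rst_step; exists f. Qed.

Lemma colim_cone_pt (p : colim D) :
  exists a (x : cone R (@ray R D a)), p = cone_pt x.
Proof.
exists (projT1 (repr p)), (projT2 (repr p)).
by rewrite /cone_pt -sigT_eta reprK.
Qed.

Lemma positive_rep (p : colim D) : exists a (x : cone R (@ray R D a)),
  p = cone_pt x /\ pos x.
Proof.
have [a [x ->]] := colim_cone_pt p; have [b [f [x' [fa <- px']]]] := arr_pos x.
by exists b, x'; rewrite -(cone_pt_arr _ fa).
Qed.

(* A positive point determines, and is determined by, the arrows it sends to the
   other representatives of its class: these sets of arrows are invariant under
   gluing, forwards by composition and backwards by factorization. *)
Lemma positive_glued a b (x : cone R (@ray R D a)) (y : cone R (@ray R D b)) :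
  pos x -> pos y -> cone_pt x = cone_pt y -> exists2 f, @arr R D a b f & f x = y.
Proof.
move=> px py /cone_pt_eqP.
pose from (q : cone_union D) :=
  exists2 f, @arr R D a (projT1 q) f & f x = projT2 q.
suff inv p q : clos_refl_sym_trans (cone_union D) (@gluing R D) p q ->
    from p <-> from q.
  move=> /inv [+ _] => /(_ _)[]; first by exists id.
  by move=> f fa fx; exists f.
elim=> {p q} [p q [f fa fp]|p|p q _ IH|p q r _ IH1 _ IH2] //.
- split=> [[k ka kx]|[k ka kx]].
    by exists (f \o k); [exact: arr_comp ka fa | rewrite /= kx].
  by apply: (arr_factor ka fa _ px); rewrite kx fp.
- by rewrite IH.
- by rewrite IH1.
Qed.

End Diagram.

(** * Arrows of the two diagrams, and purity *)

Section Moduli.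
Context {R : realType} {g n : nat}.

Lemma spin_arr_id (S : stable_spin_graph g n) : @arr R (spin_complex R g n) S S id.
Proof.
by apply/spin_arrP; exists (contr_id _); split; [exact: push_id | exact: incl_id].
Qed.

Lemma spin_arr_comp (a b c : stable_spin_graph g n) f f' :
  @arr R (spin_complex R g n) a b f -> @arr R (spin_complex R g n) b c f' ->
  @arr R (spin_complex R g n) a c (f' \o f).
Proof.
move=> /spin_arrP[m [p i]] /spin_arrP[m' [p' i']]; apply/spin_arrP.
exists (contr_comp m' m); split; last exact: incl_comp.
by apply: push_trans p' p => [v|h]; rewrite ?contr_compV ?contr_compH.
Qed.

Lemma spin_arr_factor (a b c : stable_spin_graph g n) f f' x y :
  @arr R (spin_complex R g n) a c f -> @arr R (spin_complex R g n) b c f' ->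
  f x = f' y -> positive x -> exists2 k, @arr R (spin_complex R g n) a b k & k x = y.
Proof.
move=> /spin_arrP[m [p i]] /spin_arrP[m' [p' i']] E px.
have [m0 [k [mV mH ki kx]]] := incl_factor i i' E px.
by exists k => //; apply/spin_arrP; exists m0; split=> //; exact: (push_factor mV mH p' p).
Qed.

Lemma spin_arr_pos (a : stable_spin_graph g n) (x : cone R (edge (spgraph a))) :
  exists (b : stable_spin_graph g n) f x',
  [/\ @arr R (spin_complex R g n) b a f, f x' = x & positive x'].
Proof.
have [X' [m [f [x' [fi fx px]]]]] := positive_reduction x.
have [S' p] := push_exists m (spspin a).
by exists (StableSpinGraph S'), f, x'; split=> //; apply/spin_arrP; exists m.
Qed.

Lemma curve_arr_id (S : stable_graph g n) : @arr R (curve_complex R g n) S S id.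
Proof. by apply/curve_arrP; exists (contr_id _); exact: incl_id. Qed.

Lemma curve_arr_comp (a b c : stable_graph g n) f f' :
  @arr R (curve_complex R g n) a b f -> @arr R (curve_complex R g n) b c f' ->
  @arr R (curve_complex R g n) a c (f' \o f).
Proof.
move=> /curve_arrP[m i] /curve_arrP[m' i']; apply/curve_arrP.
by exists (contr_comp m' m); exact: incl_comp.
Qed.

Lemma curve_arr_factor (a b c : stable_graph g n) f f' x y :
  @arr R (curve_complex R g n) a c f -> @arr R (curve_complex R g n) b c f' ->
  f x = f' y -> positive x -> exists2 k, @arr R (curve_complex R g n) a b k & k x = y.
Proof.
move=> /curve_arrP[m i] /curve_arrP[m' i'] E px.
have [m0 [k [mV mH ki kx]]] := incl_factor i i' E px.
by exists k => //; apply/curve_arrP; exists m0.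
Qed.

Lemma pure_dim_spin : pure_dim (spin_complex R g n) (3 * g + n - 3)%N.
Proof.
move=> [X S]; rewrite /maximal_cone /= => mx.
(* The comparison is made after adding 3, as the subtraction in [3 * g + n - 3] is truncated. *)
have [|nE] := eqVneq (#|edge X| + 3)%N (3 * genus X + n)%N.
  by move=> /(congr1 (subn^~ 3)) /=; rewrite addnK sgraph_genus.
have [W [H' [G' [m [h [sG' lm]]]]]] := expansion (sgraph_stable X) nE.
have con' : connected_graph G' by case: sG'.
have gG' : genus G' = g by rewrite -(sgraph_genus X) (contr_genus m con').
have [X' [m' l0]] := stable_obj sG' gG'.
have [m1 [m1V Vm1 m1H Hm1]] := contr_inv l0.
have [T pT] := push_lift lm S.
have [T' pT'] := push_exists m' T.
pose m2 := contr_comp m1 m.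
have [f fi] := @incl_exists R _ _ _ _ _ _ _ m2.
have p2 : push m2 T' S.
  by apply: push_trans (push_inv m1V m1H pT') pT => [v|k]; rewrite ?contr_compV ?contr_compH.
have fa : @arr R (spin_complex R g n) (StableSpinGraph S) (StableSpinGraph T') f.
  by apply/spin_arrP; exists m2.
case: (incl_range fi (h := cH m1 h)); last exact: mx fa.
apply: contraT => /lostP[k]; rewrite contr_compH => /cH_inj hk.
have : h \in lost (cH m) by rewrite lm finset.set21.
by rewrite hk (negPf (lost_im _ _)).
Qed.

End Moduli.

(** * Finiteness *)

Section Finiteness.
Local Open Scope classical_set_scope.

Lemma finite_inj (T : Type) (F : finType) (f : T -> F) :
  injective f -> finite_set [set: T].
Proof.
move=> finj; rewrite -(@preimage_setT _ _ f); apply: finite_preimage.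
  by move=> x y _ _; exact: finj.
exact: finite_finset.
Qed.

Lemma graph_eq (V H : finType) (n : nat) (G G' : graph V H n) :
  wt G =1 wt G' -> endpt G =1 endpt G' -> invol G =1 invol G' ->
  leg G =1 leg G' -> G = G'.
Proof.
case: G => w e i l a b c d; case: G' => w' e' i' l' a' b' c' d' /=.
move=> /funext ? /funext ? /funext ? /funext ?; subst.
by f_equal; exact: Prop_irrelevance.
Qed.

Lemma spin_eq (V H : finType) (n : nat) (G : graph V H n) (S S' : spin G) :
  cyc S = cyc S' ->
  (forall v, sgn S (cproj (cyc S) v) = sgn S' (cproj (cyc S') v)) -> S = S'.
Proof.
case: S => P s a b; case: S' => P' s' a' b' /= E; subst=> sE.
have {}sE : s = s' by apply/funext => C; have [v ->] := cprojP C.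
by subst; f_equal; exact: Prop_irrelevance.
Qed.

(** The domain of the sign function depends on [cyc S]. Pulling signs back to V puts them all in one
    finite type, without loss because every class has a representative. *)
Lemma finite_spin (V H : finType) (n : nat) (G : graph V H n) :
  finite_set [set: spin G].
Proof.
apply: (@finite_inj _ ({set edge G} * {ffun V -> 'Z_2})%type
  (fun S => (cyc S, [ffun v => sgn S (cproj (cyc S) v)]))) => S S' [E /ffunP sE].
by apply: spin_eq => // v; have := sE v; rewrite !ffunE.
Qed.

Variables (g n : nat).
(** Dictated by the half-edges: there are at most 2g - 2 + n vertices, so the genus formula leaves
    at most 6g - 6 + 2n half-edges on edges, and the n legs come on top. *)
Let B := (6 * g + 3 * n)%N.

Lemma stable_bounds (X : stable_graph g n) :
  [/\ (nv X <= B)%N, (nh X <= B)%N & forall v, (wt X v <= B)%N].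
Proof.
have [con st] := (stableP X).1 (sgraph_stable X).
have := sum_chi_valence con; rewrite sgraph_genus => sE.
have cst (c : int) : \sum_(v : 'I_(nv X)) c = c * (nv X)%:Z.
  by rewrite sumz_const card_ord.
have vb : ((nv X)%:Z <= (2 * g)%:Z - 2 + n%:Z).
  rewrite -sE -[X in X <= _]mul1r -cst.
  by apply: ler_sum => v _; have := st v; lia.
have wb v : (2 * wt X v <= 2 * g + n)%N.
  have : chi X v + (valence X v)%:Z <= (2 * g)%:Z - 2 + n%:Z.
    rewrite -sE (bigD1 v) //= lerDl; apply: sumr_ge0 => u _; exact/ltW/st.
  by rewrite /chi; lia.
split; first by rewrite /B; lia.
  have := genusE con; rewrite sgraph_genus card_halves cardsT.
  have := card_half_leg X; rewrite card_ord.
  have : (\sum_v chi X v >= - (2 : int) * (nv X)%:Z).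
    by rewrite -cst; apply: ler_sum => v _; rewrite /chi; lia.
  by rewrite /B; move: #|edge X| (\sum_v _) => k s; lia.
by move=> v; have := wb v; rewrite /B; lia.
Qed.

(** Functions on ['I_k] with varying k get a common domain, so that graphs of all sizes are coded in
    one finite type. The default 0 beyond k is harmless because the sizes are part of the code. *)
Definition encode (k : nat) (f : 'I_k -> nat) : {ffun 'I_B.+1 -> 'I_B.+1} :=
  [ffun i : 'I_B.+1 => inord (if insub (val i) is Some j then f j else 0%N)].

Lemma encode_inj (k : nat) (f f' : 'I_k -> nat) : (k <= B)%N ->
  (forall i, f i <= B)%N -> (forall i, f' i <= B)%N ->
  encode f = encode f' -> f =1 f'.
Proof.
move=> kB fB f'B /ffunP E i.
have iB : (i < B.+1)%N by rewrite ltnS; apply: ltnW (leq_trans (ltn_ord i) kB).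
have := E (Ordinal iB); rewrite !ffunE /= valK => /(congr1 (@nat_of_ord _)).
by rewrite !inordK // ltnS.
Qed.

Lemma finite_stable_graph : finite_set [set: stable_graph g n].
Proof.
pose T := ('I_B.+1 * 'I_B.+1 * {ffun 'I_B.+1 -> 'I_B.+1} *
  {ffun 'I_B.+1 -> 'I_B.+1} * {ffun 'I_B.+1 -> 'I_B.+1} * {ffun 'I_n -> 'I_B.+1})%type.
pose code (X : stable_graph g n) : T := (inord (nv X), inord (nh X), encode (wt X),
  encode (fun h => endpt X h), encode (fun h => invol X h),
  [ffun i => inord (leg X i)]).
apply: (@finite_inj _ T code) => X Y.
have [Xv Xh Xw] := stable_bounds X; have [Yv Yh Yw] := stable_bounds Y.
rewrite /code => -[] /(congr1 (@nat_of_ord _))/= + /(congr1 (@nat_of_ord _))/=; rewrite !inordK //.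
case: X Xv Xh Xw => k m X sX gX /= Xv Xh Xw.
case: Y Yv Yh Yw => k' m' Y sY gY /= Yv Yh Yw Ek Em; subst k' m'.
have bnd p (i : 'I_p) : (p <= B)%N -> (i <= B)%N.
  by move=> pB; apply: ltnW (leq_trans (ltn_ord i) pB).
move=> /encode_inj wE /encode_inj eE /encode_inj iE /ffunP lE.
have E : X = Y.
  apply: graph_eq => [v|h|h|i]; first exact: wE.
  - by apply: val_inj; apply: eE => // j; exact: bnd.
  - by apply: val_inj; apply: iE => // j; exact: bnd.
  - apply: val_inj; have := lE i; rewrite !ffunE => /(congr1 (@nat_of_ord _)) /=.
    by rewrite !inordK // ltnS; exact: bnd.
by subst; f_equal; exact: Prop_irrelevance.
Qed.

Lemma finite_stable_spin_graph : finite_set [set: stable_spin_graph g n].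
Proof.
rewrite (_ : [set: _] = \bigcup_(X in [set: stable_graph g n])
  [set StableSpinGraph S | S in [set: spin X]]).
  apply: bigcup_finite; first exact: finite_stable_graph.
  by move=> X _; apply: finite_image; exact: finite_spin.
by apply/seteqP; split=> // -[X S] _; exists X => //; exists S.
Qed.

Lemma spin_complexP (R : realType) :
  extended_generalized_cone_complex (spin_complex R g n).
Proof.
split; first exact: finite_stable_spin_graph.
by move=> a b f /spin_arrP[m [_]]; exact: incl_face_morphism.
Qed.

Lemma curve_complexP (R : realType) :
  extended_generalized_cone_complex (curve_complex R g n).
Proof.
split; first exact: finite_stable_graph.
by move=> a b f /curve_arrP[m]; exact: incl_face_morphism.
Qed.

End Finiteness.

(** * Topology of the colimits *)

Import numFieldNormedType.Exports.

Section ConeTopology.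
Local Open Scope classical_set_scope.
Context {R : realType}.

Lemma cone_cvg (I : finType) (T : Type) (F : set_system T) (FF : Filter F)
    (f : T -> cone R I) (x : cone R I) :
  (forall i, coord (f t) i @[t --> F] --> coord x i) -> f @ F --> x.
Proof.
move=> fx U [?/= [[W oW <-]]] /= Wx /filterS; apply.
have : (fun t => set_val (f t)) @ F --> (set_val x : {ptws I -> \bar R}).
  apply/cvg_sup => i B [V] [[Z] oZ <-] Zi ZB; apply: (filterS ZB).
  by apply: (fx i); apply: open_nbhs_nbhs.
by apply; apply: open_nbhs_nbhs.
Qed.

Lemma cone_continuous (I : finType) (T : topologicalType) (f : T -> cone R I) :
  (forall i, continuous (fun t => coord (f t) i)) -> continuous f.
Proof. by move=> fc t; apply: cone_cvg => i; exact: fc. Qed.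

Lemma coord_continuous (I : finType) (i : I) :
  continuous (fun x : cone R I => coord x i).
Proof.
move=> x; apply: (@continuous_comp _ _ _ set_val (fun y : {ptws I -> \bar R} => y i)).
  exact: initial_continuous.
exact: (@proj_continuous I (fun=> \bar R) i).
Qed.

(** Multiplication by t jumps at t = 0 on an infinite coordinate, so rays to the origin connect only
    the finite points; these are dense. *)
Definition finite_cone (I : finType) : set (cone R I) :=
  [set x | forall i, coord x i \is a fin_num].

Lemma ray_point_ge0 (I : finType) (r : I -> {nonneg R}) (t : R) (i : I) :
  (0 <= (`|t| * (r i)%:num)%:E)%E.
Proof. by rewrite lee_fin mulr_ge0. Qed.

(** The absolute value lets t range over the whole connected line while the point stays in the
    orthant. *)
Definition ray_point (I : finType) (r : I -> {nonneg R}) (t : R) : cone R I :=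
  mk_cone (ray_point_ge0 r t).

Lemma ray_point_continuous (I : finType) (r : I -> {nonneg R}) :
  continuous (ray_point r : R -> cone R I).
Proof.
apply: cone_continuous => i t.
apply: cvg_EFin; first by apply: nearW.
apply: cvgMl; apply: cvg_norm; exact: cvg_id.
Qed.

Lemma finite_cone_connected (I : finType) : connected (@finite_cone I).
Proof.
rewrite (_ : @finite_cone I = \bigcup_(r in [set: I -> {nonneg R}])
    (ray_point r @` [set: R])); last first.
  apply/seteqP; split=> [x xf|_ [r _ [t _ <-]] i //].
  have x0 i : 0 <= fine (coord x i) by apply: fine_ge0; exact: coord_ge0.
  exists (fun i => NngNum (x0 i)) => //; exists 1 => //.
  by apply: cone_ext => i; rewrite mk_coneE /= normr1 mul1r fineK.
apply: bigcup_connected.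
  exists (mk_cone (fun i : I => lexx (0 : \bar R))) => r _; exists 0 => //.
  by apply: cone_ext => i; rewrite !mk_coneE normr0 mul0r.
move=> r _; apply: (@connected_continuous_connected R (cone R I) [set: R] (ray_point r)).
  by apply/connected_intervalP => x y _ _ z _.
by apply: continuous_subspaceT; exact: ray_point_continuous.
Qed.

Lemma finite_cone_dense (I : finType) : closure (@finite_cone I) = setT.
Proof.
apply/seteqP; split=> // x _.
(* The approximating sequence replaces infinite coordinates by k and keeps the others. *)
have ge (i : I) (k : nat) :
    (0 <= if coord x i == +oo%E then k%:R%:E else coord x i)%E.
  by case: ifP => _; rewrite ?coord_ge0 // lee_fin.
pose u (k : nat) : cone R I := mk_cone (fun i => ge i k).
have ux : u @ \oo --> x.
  apply: cone_cvg => i; rewrite /u /=.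
  under eq_fun do rewrite mk_coneE.
  case: eqP => [->|_]; last exact: cvg_cst.
  exact/cvgeryP/cvgr_idn.
move=> B /ux [N _ NB]; exists (u N); split; last by apply: NB => /=.
move=> i; rewrite mk_coneE; case: eqP => // /eqP xi.
by rewrite ge0_fin_numE ?coord_ge0 // lt_neqAle xi leey.
Qed.

Lemma cone_connected (I : finType) : connected [set: cone R I].
Proof.
rewrite -finite_cone_dense; apply: connected_closure; exact: finite_cone_connected.
Qed.

End ConeTopology.

Section ColimTopology.
Local Open Scope classical_set_scope.
Local Open Scope quotient_scope.
Context {R : realType} (D : cone_diagram R).

Lemma cone_pt_continuous (a : obj D) : continuous (@cone_pt R D a).
Proof.
by apply/continuousP => U oU; exact: ((sigT_openP _).1 oU a).
Qed.

Lemma colim_lift (T : Type) (phi : forall a : obj D, cone R (ray a) -> T) :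
  (forall a b f x, @arr R D a b f -> phi b (f x) = phi a x) ->
  exists psi : colim D -> T, forall a x, psi (@cone_pt R D a x) = phi a x.
Proof.
move=> phiE.
have E p q : clos_refl_sym_trans (cone_union D) (@gluing R D) p q ->
    phi (projT1 p) (projT2 p) = phi (projT1 q) (projT2 q).
  elim=> {p q} [p q [f fa <-]|p|p q _ ->|p q r _ -> _ ->] //.
  by rewrite phiE.
exists (fun p => phi (projT1 (repr p)) (projT2 (repr p))) => a x.
have Q : cone_pt (projT2 (repr (cone_pt x))) = cone_pt x.
  by rewrite {1}/cone_pt -sigT_eta reprK.
exact: (E _ _ ((cone_pt_eqP _ _).1 Q)).
Qed.

Lemma colim_open (U : set (colim D)) :
  (forall a, open (@cone_pt R D a @^-1` U)) -> open U.
Proof. by move=> oU; apply/sigT_openP => a; exact: oU. Qed.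

Lemma colim_continuous (T : topologicalType) (psi : colim D -> T) :
  (forall a, continuous (fun x => psi (@cone_pt R D a x))) -> continuous psi.
Proof.
move=> pc; apply/continuousP => U oU; apply: colim_open => a.
by move/continuousP: (pc a); exact.
Qed.

End ColimTopology.

Section Components.
Local Open Scope classical_set_scope.
Context {T : topologicalType}.

Lemma component_clopen (A : set T) x :
  open A -> closed A -> connected A -> A x -> connected_component [set: T] x = A.
Proof.
move=> oA cA conA Ax; apply/seteqP; split; last first.
  exact: connected_component_max.
have : connected_component [set: T] x `&` A = connected_component [set: T] x.
  apply: (@component_connected _ [set: T] x); last 2 first.
  - by exists A.
  - by exists A.
  by exists x; split=> //; exact: connected_component_refl.
by move=> <-; exact: subIsetr.
Qed.

End Components.

(** * Parity loci *)

Lemma trivial_spin (V H : finType) (n : nat) (G : graph V H n) : inhabited (spin G).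
Proof.
split; apply: (@Spin _ _ _ G finset.set0 (fun=> 0)) => // v.
rewrite (_ : [set _ in _ | _] = finset.set0) ?cards0 //.
apply/setP => h; rewrite !finset.inE; apply/negP => /andP[/halvesP[e]].
by rewrite finset.in_set0.
Qed.

(** * The graph with one vertex and no edges *)

Section OneVertex.
Variables (g n : nat).

Lemma one_vertex_gt0 : (0 < #|'I_1|)%N. Proof. by rewrite card_ord. Qed.

Lemma one_legP (h : 'I_n) : h = h <-> exists i, h = id i.
Proof. by split=> // _; exists h. Qed.

Definition one_vertex : graph 'I_1 'I_n n :=
  @Graph 'I_1 'I_n n (fun=> g) (fun=> ord0) id id one_vertex_gt0
    (fun=> erefl) (fun _ _ => id) one_legP.

Lemma one_vertex_noedge (h : 'I_n) (F : {set edge one_vertex}) : h \notin halves F.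
Proof. by apply/negP => /halves_edgewise[_]; rewrite eqxx. Qed.

Lemma one_vertex_halves (F : {set edge one_vertex}) : halves F = finset.set0.
Proof.
apply/setP => h; rewrite finset.in_set0; apply: negbTE; exact: one_vertex_noedge.
Qed.

Lemma one_vertex_cyc (F F' : {set edge one_vertex}) : F = F'.
Proof. by apply: halves_inj; rewrite !one_vertex_halves. Qed.

Lemma one_vertex_connected : connected_graph one_vertex.
Proof. by apply/connected_graphP => u v; rewrite (ord1 u) (ord1 v) connect0. Qed.

Lemma one_vertex_chi v : chi one_vertex v = (2 * g)%:Z - 2.
Proof. by []. Qed.

Lemma one_vertex_genus : genus one_vertex = g.
Proof.
have := genusE one_vertex_connected; rewrite one_vertex_halves cards0 addr0.
by rewrite big_ord1 one_vertex_chi; lia.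
Qed.

Hypothesis gn : (2 < 2 * g + n)%N.

Lemma one_vertex_stable : stable one_vertex.
Proof.
apply/stableP; split; first exact: one_vertex_connected.
move=> v; rewrite one_vertex_chi /valence (_ : #|_| = n); first lia.
by rewrite -[RHS]card_ord; apply: eq_card => h; rewrite finset.inE (ord1 v).
Qed.

Definition one_vertex_obj : stable_graph g n :=
  StableGraph one_vertex_stable one_vertex_genus.

Lemma one_vertex_wt (F : {set edge one_vertex}) (C : cvertex F) :
  wt (contraction F) C = g.
Proof.
have [|a _] := @iso_of_contr _ _ _ _ _ _ _ (contr_of F).
  by rewrite lost_contr_of one_vertex_halves.
by have [s _ Ks] := isoV_bij a; rewrite -(Ks C) iso_wt.
Qed.

Lemma one_vertex_cvertex (F : {set edge one_vertex}) (C : cvertex F) :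
  C = cproj F ord0.
Proof. by have [v ->] := cprojP C; rewrite (ord1 v). Qed.

Lemma one_vertex_parity (S : spin one_vertex) C : sgn S C = parity S.
Proof.
rewrite /parity (big_pred1 C) // => C' /=.
by rewrite (one_vertex_cvertex C') (one_vertex_cvertex C) eqxx.
Qed.

Lemma one_vertex_spin_eq (S S' : spin one_vertex) : parity S = parity S' -> S = S'.
Proof.
by move=> E; apply: spin_eq => [|v]; [exact: one_vertex_cyc | rewrite !one_vertex_parity].
Qed.

(** The vertex of the quotient has weight g, and a nonzero sign is allowed only in positive
    weight. *)
Lemma one_vertex_spin (b : 'Z_2) : (0 < g)%N -> exists S : spin one_vertex, parity S = b.
Proof.
move=> g0; unshelve eexists; first unshelve eapply (@Spin _ _ _ one_vertex finset.set0 (fun=> b)).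
- move=> v; rewrite one_vertex_halves (_ : [set _ in _ | _] = finset.set0) ?cards0 //.
  by apply/setP => h; rewrite !finset.inE.
- by move=> C; rewrite one_vertex_wt => g00; rewrite g00 in g0.
rewrite /parity /= (big_pred1 (cproj finset.set0 ord0)) // => C /=.
by rewrite (one_vertex_cvertex C) eqxx.
Qed.

(** For the constant map, connectedness of G is the condition [cV_conn] and the genus formula is
    [cV_chi]. *)
Lemma one_vertex_contr (V H : finType) (G : graph V H n) :
  connected_graph G -> genus G = g -> exists m : contr G one_vertex,
    lost (cH m) = halves [set: edge G].
Proof.
move=> con gG.
have lE : lost (leg G) = halves [set: edge G].
  apply/setP => h; rewrite mem_halvesT; apply/idP/idP => [hl|hN].
    apply/eqP => /legP[i E]; move: hl; by rewrite E (negPf (lost_im _ _)).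
  apply: contraT => /lostP[i E]; move/eqP: hN; case.
  by apply/legP; exists i.
unshelve eexists; first unshelve eapply (@Contr _ _ _ _ _ G one_vertex (fun=> ord0) (leg G)).
- exact: leg_inj.
- by [].
- by move=> i /=; apply/legP; exists i.
- by [].
- by move=> v; have /card_gt0P[u _] := graph_vertex G; exists u; rewrite (ord1 v).
- by move=> u v; rewrite eqxx lE; apply/esym; exact: (connected_graphP G).1.
- move=> v; rewrite one_vertex_chi -gG genusE // -lE; congr (_ + Posz _).
    by apply: eq_bigl => u; rewrite (ord1 v).
  by apply: eq_card => h; rewrite finset.inE (ord1 v) andbT.
by [].
Qed.

End OneVertex.

Section ParityLoci.
Local Open Scope classical_set_scope.
Context {R : realType} {g n : nat} (gn : (2 < 2 * g + n)%N).

Local Notation locus := (@parity_locus R g n).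

Definition zero_cone (I : finType) : cone R I := mk_cone (fun=> lexx (0 : \bar R)).

Lemma hcoord_zero (V H : finType) (G : graph V H n) h :
  hcoord (zero_cone (edge G)) h = 0%E.
Proof. by rewrite /hcoord; case: pickP. Qed.

(* Contracting all edges leaves a one-vertex graph, whose spin structures are
   determined by their parity. *)
Lemma origin_eq (S S' : stable_spin_graph g n) :
  parity (spspin S) = parity (spspin S') ->
  @cone_pt R (spin_complex R g n) S (zero_cone _) =
  @cone_pt R (spin_complex R g n) S' (zero_cone _).
Proof.
have key (T : stable_spin_graph g n) : exists T' : spin (one_vertex g n),
    parity T' = parity (spspin T) /\
    @cone_pt R (spin_complex R g n) T (zero_cone _) =
    @cone_pt R (spin_complex R g n)
      (@StableSpinGraph g n (one_vertex_obj gn) T') (zero_cone _).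
  have [con _] := sgraph_stable (spgraph T).
  have [m _] := one_vertex_contr con (sgraph_genus (spgraph T)).
  have [T' p] := push_exists m (spspin T).
  have [f fi] := @incl_exists R _ _ _ _ _ _ _ m.
  exists T'; split; first exact: push_parity p.
  have fa : @arr R (spin_complex R g n)
      (@StableSpinGraph g n (one_vertex_obj gn) T') T f.
    by apply/spin_arrP; exists m.
  rewrite (cone_pt_arr _ fa); congr cone_pt; apply/esym.
  by apply/(inclP _ _ fi); split=> h *; rewrite !hcoord_zero.
have [T [pT ->]] := key S; have [T' [pT' ->]] := key S'.
by move=> E; rewrite (@one_vertex_spin_eq g n T T') // pT pT'.
Qed.

Lemma parity_lift : exists psi : Sbar R g n -> 'Z_2,
  forall (S : stable_spin_graph g n) x,
    psi (@cone_pt R (spin_complex R g n) S x) = parity (spspin S).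
Proof.
apply: (@colim_lift R (spin_complex R g n) _
  (fun (S : stable_spin_graph g n) _ => parity (spspin S))).
by move=> S S' f x /spin_arrP[m [p _]]; rewrite (push_parity p).
Qed.

Lemma parity_locusP (S : stable_spin_graph g n) x b :
  locus b (@cone_pt R (spin_complex R g n) S x) <-> parity (spspin S) = b.
Proof.
have [psi psiE] := parity_lift; split=> [[S' pS' [y /(congr1 psi)]]|E].
  by rewrite !psiE pS'.
by exists S => //; exists x.
Qed.

Lemma locus_open b : open (locus b).
Proof.
apply: colim_open => S; have [E|nE] := eqVneq (parity (spspin S)) b.
  rewrite (_ : _ @^-1` _ = setT); first exact: openT.
  by apply/seteqP; split=> // x _; apply/parity_locusP.
rewrite (_ : _ @^-1` _ = set0); first exact: open0.
by apply/seteqP; split=> // x /= /parity_locusP E; rewrite E eqxx in nE.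
Qed.

Lemma locus_cover (p : Sbar R g n) : locus 0 p \/ locus 1 p.
Proof.
have [S [x ->]] := colim_cone_pt p.
rewrite !parity_locusP; case: (parity _) => -[|[|//]] i; [left|right]; exact: val_inj.
Qed.

Lemma locus_disjoint (p : Sbar R g n) b b' : locus b p -> locus b' p -> b = b'.
Proof.
by have [S [x ->]] := colim_cone_pt p; rewrite !parity_locusP => <- <-.
Qed.

Lemma locus_closed b : closed (locus b).
Proof.
rewrite (_ : locus b = ~` locus (1 - b)); first exact/open_closedC/locus_open.
apply/seteqP; split=> p.
  move=> pb pb'; have := locus_disjoint pb pb'.
  by case: b {pb pb'} => -[|[|//]] i /(congr1 val).
have [p0|p1] := locus_cover p.
  by case: b => -[|[|//]] i nb; [rewrite (_ : Ordinal i = 0) //; exact: val_inj |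
    case: nb; rewrite (_ : _ - _ = 0) //; exact: val_inj].
by case: b => -[|[|//]] i nb; [
    case: nb; rewrite (_ : _ - _ = 1) //; exact: val_inj |
    rewrite (_ : Ordinal i = 1) //; exact: val_inj].
Qed.

Lemma locus_connected b : connected (locus b).
Proof.
rewrite (_ : locus b = \bigcup_(S in [set S : stable_spin_graph g n | parity (spspin S) = b])
    (@cone_pt R (spin_complex R g n) S @` [set: cone R (edge (spgraph S))])); last first.
  apply/seteqP; split=> [_ [S pS [x ->]]|_ [S pS [x _ <-]]].
    by exists S => //; exists x.
  by exists S => //; exists x.
have [[S0 pS0]|nS] := pselect (exists S : stable_spin_graph g n, parity (spspin S) = b).
  apply: bigcup_connected.
    exists (@cone_pt R (spin_complex R g n) S0 (zero_cone _)) => S pS.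
    by exists (zero_cone _) => //; apply: origin_eq; rewrite pS.
  move=> S _; apply: connected_continuous_connected; first exact: cone_connected.
  by apply: continuous_subspaceT; exact: (@cone_pt_continuous R (spin_complex R g n) S).
rewrite (_ : [set S | _] = set0) ?bigcup_set0; first exact: connected0.
by apply/seteqP; split=> // S pS; case: nS; exists S.
Qed.

Lemma locus_component (p : Sbar R g n) b : locus b p ->
  connected_component [set: Sbar R g n] p = locus b.
Proof.
apply: component_clopen; [exact: locus_open | exact: locus_closed | exact: locus_connected].
Qed.

Lemma locus_nonempty b : (0 < g)%N -> locus b !=set0.
Proof.
move=> g0; have [S pS] := one_vertex_spin n b g0.
exists (@cone_pt R (spin_complex R g n)
  (@StableSpinGraph g n (one_vertex_obj gn) S) (zero_cone _)).
by apply/parity_locusP.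
Qed.

Lemma components_pos : (0 < g)%N ->
  conn_components (Sbar R g n) = [set locus 0; locus 1] /\ locus 0 <> locus 1.
Proof.
move=> g0; split; last first.
  move=> E; have [p p0] := locus_nonempty 0 g0.
  by have := p0; rewrite E => /(locus_disjoint p0)/(congr1 val).
apply/seteqP; split=> [_ [p _ <-]|_ [->|->]].
- by have [/locus_component->|/locus_component->] := locus_cover p; [left|right].
- by have [p p0] := locus_nonempty 0 g0; exists p => //; exact: locus_component.
- by have [p p0] := locus_nonempty 1 g0; exists p => //; exact: locus_component.
Qed.

(** Contracting to one vertex keeps the parity, and there weight zero forces the only sign to be
    0. *)
Lemma locus1_genus0 : g = 0%N -> locus 1 = set0.
Proof.
move=> g0; apply/seteqP; split=> // q [S pS _] /=.
have [con _] := sgraph_stable (spgraph S).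
have [m _] := one_vertex_contr con (sgraph_genus (spgraph S)).
have [T p] := push_exists m (spspin S).
have : parity T = 0.
  rewrite -(@one_vertex_parity _ _ T (cproj (cyc T) ord0)).
  by apply: sgnP; rewrite one_vertex_wt.
by rewrite (push_parity p) [parity _]pS => /(congr1 val).
Qed.

Lemma components_zero : g = 0%N ->
  conn_components (Sbar R g n) = [set locus 0] /\ locus 1 = set0.
Proof.
move=> g0; have l1 := locus1_genus0 g0; split=> //.
have l0 p : locus 0 p by have [//|] := locus_cover p; rewrite l1.
apply/seteqP; split=> [_ [p _ <-]|_ ->]; first exact: locus_component.
have [S] := trivial_spin (one_vertex g n).
exists (@cone_pt R (spin_complex R g n)
  (@StableSpinGraph g n (one_vertex_obj gn) S) (zero_cone _)) => //.
exact: locus_component.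
Qed.

End ParityLoci.

(** * The map pi and its fibres *)

Section PiCone.
Context {R : realType} {V H : finType} {n : nat} {G : graph V H n} (S : spin G).

Lemma pi_cone_subproof (x : cone R (edge G)) (e : edge G) :
  (0 <= if e \in cyc S then coord x e else 2%:E * coord x e)%E.
Proof. by case: ifP => _; rewrite ?mule_ge0 ?coord_ge0. Qed.

(** Extends [pi_curve] to points with vanishing coordinates, since cones are glued along the faces
    that consist of them. *)
Definition pi_cone (x : cone R (edge G)) : cone R (edge G) :=
  mk_cone (pi_cone_subproof x).

Lemma pi_cone_hcoord x h : hcoord (pi_cone x) h =
  if h \in halves (cyc S) then hcoord x h else (2%:E * hcoord x h)%E.
Proof.
have [hh|/half_edge[e he]] := eqVneq (invol G h) h.
  by rewrite !hcoord_leg // mule0 if_same.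
by rewrite !(hcoordE _ he) mk_coneE (mem_halves _ he).
Qed.

Lemma pi_cone_linear : integral_linear pi_cone.
Proof.
apply: monomial_linear => e; left; have [eP|eP] := boolP (e \in cyc S).
  by exists 1, e => x; rewrite mk_coneE eP mul1e.
by exists 2, e => x; rewrite mk_coneE (negPf eP).
Qed.

Lemma pi_cone_continuous : continuous pi_cone.
Proof.
apply: cone_continuous => e.
(* Doubling is written as x + x because addition is continuous at pairs of nonnegative values,
   infinity included. *)
rewrite (_ : (fun x => _) = (fun x : cone R (edge G) =>
    if e \in cyc S then coord x e else (coord x e + coord x e)%E)); last first.
  by apply/funext => x; rewrite mk_coneE; case: ifP => // _; rewrite -mule2n mule_natl.
case: (e \in cyc S) => x; first exact: coord_continuous.
apply: cvgeD; last 2 first.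
- exact: coord_continuous.
- exact: coord_continuous.
- exact: nbhs_filter.
- by apply: ge0_adde_def; rewrite inE coord_ge0.
Qed.

End PiCone.

Section PiMap.
Local Open Scope classical_set_scope.
Context {R : realType} {g n : nat}.

(** A surviving edge lies in P exactly when it lies in P', so it is doubled on both sides of a face
    inclusion or on neither; a contracted edge has length 0, which doubling fixes. *)
Lemma pi_exists : exists pi : Sbar R g n -> Mbar R g n,
  forall (S : stable_spin_graph g n) (x : cone R (edge (spgraph S))),
    pi (@cone_pt R (spin_complex R g n) S x) =
    @cone_pt R (curve_complex R g n) (spgraph S) (pi_cone (spspin S) x).
Proof.
apply: (@colim_lift R (spin_complex R g n) _ (fun (S : stable_spin_graph g n) x =>
  @cone_pt R (curve_complex R g n) (spgraph S) (pi_cone (spspin S) x))).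
move=> S' S f x /spin_arrP[m [[c _] fi]].
have fa : @arr R (curve_complex R g n) (spgraph S') (spgraph S) f.
  by apply/curve_arrP; exists m.
rewrite (cone_pt_arr _ fa); congr cone_pt; apply/esym/(inclP _ _ fi).
split=> h; rewrite !pi_cone_hcoord ?c.
  by rewrite (fi x).1.
by move=> hl; rewrite (fi x).2 // mule0 if_same.
Qed.

Lemma pi_morphism (pi : Sbar R g n -> Mbar R g n) :
  (forall (S : stable_spin_graph g n) (x : cone R (edge (spgraph S))),
    pi (@cone_pt R (spin_complex R g n) S x) =
    @cone_pt R (curve_complex R g n) (spgraph S) (pi_cone (spspin S) x)) ->
  @cone_complex_morphism R (spin_complex R g n) (curve_complex R g n) pi.
Proof.
move=> piE; split; last first.
  move=> S; exists (spgraph S), (pi_cone (spspin S)).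
  by split; [exact: pi_cone_linear | exact: piE].
apply: (@colim_continuous R (spin_complex R g n)) => S.
rewrite (_ : (fun x => _) = @cone_pt R (curve_complex R g n) (spgraph S) \o
    pi_cone (spspin S)); last by apply/funext => x; exact: piE.
move=> x; apply: continuous_comp; first exact: pi_cone_continuous.
exact: (@cone_pt_continuous R (curve_complex R g n) (spgraph S)).
Qed.

End PiMap.

Section Curves.
Local Open Scope classical_set_scope.
Context {R : realType} {V H : finType} {n : nat} {G : graph V H n}.

Lemma curve_eq (Gamma Gamma' : curve R G) :
  (forall e, len Gamma e = len Gamma' e) -> Gamma = Gamma'.
Proof.
case: Gamma => l p; case: Gamma' => l' p' /= /funext E; subst.
by f_equal; exact: Prop_irrelevance.
Qed.

Lemma curve_cone_coord (Gamma : curve R G) e : coord (curve_cone Gamma) e = len Gamma e.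
Proof. by []. Qed.

Lemma curve_cone_positive (Gamma : curve R G) : positive (curve_cone Gamma).
Proof. by move=> e; rewrite curve_cone_coord; apply/eqP; rewrite gt_eqF // len_gt0. Qed.

Lemma positive_curve (x : cone R (edge G)) : positive x ->
  exists Gamma : curve R G, curve_cone Gamma = x.
Proof.
move=> px; have l0 e : (0 < coord x e)%E.
  by rewrite lt_neqAle coord_ge0 andbT eq_sym; apply/eqP; exact: px.
by exists (Curve l0); apply: cone_ext.
Qed.

Lemma pi_curve_cone (Gamma : curve R G) (S : spin G) :
  curve_cone (pi_curve Gamma S) = pi_cone S (curve_cone Gamma).
Proof. by apply: cone_ext. Qed.

Lemma half_double (x : \bar R) : (2%:E * ((2^-1)%:E * x) = x)%E.
Proof. by rewrite muleA -EFinM divff ?pnatr_eq0 // mul1e. Qed.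

Lemma double_half (x : \bar R) : ((2^-1)%:E * (2%:E * x) = x)%E.
Proof. by rewrite muleA -EFinM mulVf ?pnatr_eq0 // mul1e. Qed.

Lemma half_curve_subproof (Gamma : curve R G) (S : spin G) e :
  (0 < if e \in cyc S then len Gamma e else (2^-1)%:E * len Gamma e)%E.
Proof.
by case: ifP => _; rewrite ?mule_gt0 ?len_gt0 // lte_fin invr_gt0 ltr0n.
Qed.

(** The only curve that [pi_curve] sends to Gamma for the given S; halving inverts doubling at
    infinity too. *)
Definition half_curve (Gamma : curve R G) (S : spin G) : curve R G :=
  Curve (half_curve_subproof Gamma S).

Lemma half_curveK (Gamma : curve R G) (S : spin G) :
  pi_curve (half_curve Gamma S) S = Gamma.
Proof. by apply: curve_eq => e /=; case E: (e \in cyc S); rewrite /= ?E ?half_double. Qed.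

Lemma pi_curveK (Gamma : curve R G) (S : spin G) :
  half_curve (pi_curve Gamma S) S = Gamma.
Proof. by apply: curve_eq => e /=; case E: (e \in cyc S); rewrite /= ?E ?double_half. Qed.

End Curves.

Section Classes.
Context {R : realType} {V H V' H' : finType} {n : nat}.
Context {G : graph V H n} {G' : graph V' H' n}.

Definition isometry (a : iso G G') (Gamma : curve R G) (Gamma' : curve R G') :=
  forall e, len Gamma' (iso_edge a e) = len Gamma e.

Lemma isometryP (a : iso G G') (Gamma : curve R G) (Gamma' : curve R G') :
  isometry a Gamma Gamma' <->
  (forall h, hcoord (curve_cone Gamma) (cH (contr_iso a) h) =
             hcoord (curve_cone Gamma') h).
Proof.
have E h : hcoord (curve_cone Gamma') (isoH a h) = hcoord (curve_cone Gamma) h <->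
  forall e : edge G, h \in val e -> len Gamma' (iso_edge a e) = len Gamma e.
  split=> [+ e he|hE].
    by rewrite (hcoordE _ he) (@hcoordE _ _ _ _ _ _ (iso_edge a e)) //= imset_f.
  have [hh|/half_edge[e he]] := eqVneq (invol G h) h.
    by rewrite !hcoord_leg // iso_inv hh.
  rewrite (hcoordE _ he) (@hcoordE _ _ _ _ _ _ (iso_edge a e)).
    by rewrite !curve_cone_coord hE.
  by rewrite /= imset_f.
split=> [iE h|hE e].
  by rewrite -{2}[h](contr_isoH a); apply/esym/E => e _; exact: iE.
have [h he] := edge_half e; apply: (E h).1 he.
by rewrite -hE; congr hcoord; apply: (bij_inj (isoH_bij a)); rewrite contr_isoH.
Qed.

Lemma isometry_incl (a : iso G G') (Gamma : curve R G) (Gamma' : curve R G')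
    (f : cone R (edge G') -> cone R (edge G)) : incl (contr_iso a) f ->
  isometry a Gamma Gamma' <-> f (curve_cone Gamma') = curve_cone Gamma.
Proof.
move=> fi; rewrite isometryP; split=> [E|/(inclP _ _ fi)[]//].
by apply/(inclP _ _ fi); split=> // h; rewrite lost_contr_iso finset.in_set0.
Qed.

(** A lost half-edge would have length zero in Gamma, where all lengths are positive; so m loses
    nothing. *)
Lemma incl_isometry (m : contr G G') (Gamma : curve R G) (Gamma' : curve R G')
    (f : cone R (edge G') -> cone R (edge G)) : incl m f ->
  f (curve_cone Gamma') = curve_cone Gamma ->
  exists a : iso G G', [/\ isometry a Gamma Gamma',
    forall v, cV (contr_iso a) v = cV m v & forall h, cH (contr_iso a) h = cH m h].
Proof.
move=> fi E; have [E1 E2] := (inclP _ _ fi).1 E.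
have l0 : lost (cH m) = finset.set0.
  apply/setP => h; rewrite finset.in_set0; apply/negP => hl.
  have [_ hN] := lost_edgewise hl.
  by have := positiveP (@curve_cone_positive _ _ _ _ _ Gamma) hN; rewrite E2.
have [a [aV aH]] := iso_of_contr l0.
have aH' h : cH (contr_iso a) h = cH m h.
  by apply: (bij_inj (isoH_bij a)); rewrite contr_isoH aH.
exists a; split=> // [|v]; last by rewrite contr_isoV aV.
by apply/isometryP => h; rewrite aH' E1.
Qed.

(** The isomorphism carries the cycle of S to that of S', so it respects which edges are doubled,
    and doubling is injective. *)
Lemma isometry_pi (a : iso G G') (S : spin G) (S' : spin G')
    (Gamma : curve R G) (Gamma' : curve R G') : spin_iso a S S' ->
  isometry a (pi_curve Gamma S) (pi_curve Gamma' S') <-> isometry a Gamma Gamma'.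
Proof.
move=> [cE _].
have mE e : (iso_edge a e \in cyc S') = (e \in cyc S).
  rewrite cE mem_imset // => e1 e2 /(congr1 val)/=.
  by move/(imset_inj (bij_inj (isoH_bij a))) => E; exact: val_inj.
split=> iE e; have := iE e; rewrite /= mE; case: ifP => // _.
  by move=> /(congr1 (fun x => (2^-1)%:E * x)%E); rewrite !double_half.
by move=> ->.
Qed.

End Classes.

(** * Fibres of pi as sets of orbits *)

Section Fibres.
Local Open Scope classical_set_scope.
Context {R : realType} {g n : nat}.

Lemma curve_glued (X Y : stable_graph g n) (x : cone R (edge X)) (y : cone R (edge Y)) :
  positive x -> positive y ->
  @cone_pt R (curve_complex R g n) X x = @cone_pt R (curve_complex R g n) Y y ->
  exists2 f, @arr R (curve_complex R g n) X Y f & f x = y.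
Proof.
apply: (@positive_glued R (curve_complex R g n)
  (fun (a : stable_graph g n) z => @positive R _ _ _ a z)).
- exact: curve_arr_id.
- exact: curve_arr_comp.
- exact: curve_arr_factor.
Qed.

Lemma spin_glued (X Y : stable_spin_graph g n) (x : cone R (edge (spgraph X)))
    (y : cone R (edge (spgraph Y))) :
  positive x -> positive y ->
  @cone_pt R (spin_complex R g n) X x = @cone_pt R (spin_complex R g n) Y y ->
  exists2 f, @arr R (spin_complex R g n) X Y f & f x = y.
Proof.
apply: (@positive_glued R (spin_complex R g n)
  (fun (a : stable_spin_graph g n) z => @positive R _ _ _ (spgraph a) z)).
- exact: spin_arr_id.
- exact: spin_arr_comp.
- exact: spin_arr_factor.
Qed.

Lemma spin_positive_rep (p : Sbar R g n) :
  exists (G : stable_graph g n) (S : spin G) (Gamma : curve R G),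
    p = spin_curve_class Gamma S.
Proof.
have [[G S] [x [-> px]]] := @positive_rep R (spin_complex R g n)
  (fun (a : stable_spin_graph g n) z => @positive R _ _ _ (spgraph a) z)
  (@spin_arr_pos R g n) p.
by have [Gamma <-] := positive_curve px; exists G, S, Gamma.
Qed.

Lemma curve_class_eqP (G G' : stable_graph g n) (Gamma : curve R G) (Gamma' : curve R G') :
  curve_class Gamma = curve_class Gamma' <-> exists a : iso G G', isometry a Gamma Gamma'.
Proof.
split=> [E|[a ia]].
  have [f /curve_arrP[m fi] fE] := curve_glued
    (@curve_cone_positive _ _ _ _ _ Gamma') (@curve_cone_positive _ _ _ _ _ Gamma) (esym E).
  by have [a [ia _ _]] := incl_isometry fi fE; exists a.
have [f fi] := @incl_exists R _ _ _ _ _ _ _ (contr_iso a).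
have fa : @arr R (curve_complex R g n) G' G f by apply/curve_arrP; exists (contr_iso a).
by rewrite /curve_class -((isometry_incl _ _ fi).1 ia) -(cone_pt_arr _ fa).
Qed.

Lemma spin_class_eqP (G G' : stable_graph g n) (Gamma : curve R G) (Gamma' : curve R G')
    (S : spin G) (S' : spin G') :
  spin_curve_class Gamma S = spin_curve_class Gamma' S' <->
  exists a : iso G G', isometry a Gamma Gamma' /\ spin_iso a S S'.
Proof.
split=> [E|[a [ia sa]]].
  have [f /spin_arrP[m [p fi]] fE] := @spin_glued
    (StableSpinGraph S') (StableSpinGraph S) _ _
    (@curve_cone_positive _ _ _ _ _ Gamma') (@curve_cone_positive _ _ _ _ _ Gamma) (esym E).
  have [a [ia aV aH]] := incl_isometry fi fE; exists a; split=> //.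
  by apply/spin_isoE; apply: push_eq p => [v|h]; rewrite ?aV ?aH.
have [f fi] := @incl_exists R _ _ _ _ _ _ _ (contr_iso a).
have fa : @arr R (spin_complex R g n) (StableSpinGraph S') (StableSpinGraph S) f.
  by apply/spin_arrP; exists (contr_iso a); split=> //; exact/spin_isoE.
by rewrite /spin_curve_class -((isometry_incl _ _ fi).1 ia) -(cone_pt_arr _ fa).
Qed.

(** The curve above Gamma depends on the spin structure, as its cycle decides which edges are
    halved. An isomorphism carrying S to S' matches these choices, so it is an isometry of the
    halved curves exactly when it preserves the lengths of Gamma. *)
Lemma spin_orbitP (G : stable_graph g n) (Gamma : curve R G) (S S' : spin G) :
  spin_orbit Gamma S S' <->
  spin_curve_class (half_curve Gamma S) S = spin_curve_class (half_curve Gamma S') S'.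
Proof.
rewrite spin_class_eqP; split=> -[a [ia sa]]; exists a; split=> //.
  by apply/(isometry_pi _ _ sa); rewrite !half_curveK.
by move/(isometry_pi _ _ sa): ia; rewrite !half_curveK.
Qed.

Lemma spin_orbit_eqP (G : stable_graph g n) (Gamma : curve R G) (S S' : spin G) :
  spin_orbit Gamma S = spin_orbit Gamma S' <->
  spin_curve_class (half_curve Gamma S) S = spin_curve_class (half_curve Gamma S') S'.
Proof.
split=> [E|E].
  apply/spin_orbitP; rewrite E; exact/spin_orbitP.
by apply/seteqP; split=> T /spin_orbitP TE; apply/spin_orbitP; rewrite ?E // -E.
Qed.

Lemma fibre_bijection (pi : Sbar R g n -> Mbar R g n) :
  (forall (S : stable_spin_graph g n) (x : cone R (edge (spgraph S))),
    pi (@cone_pt R (spin_complex R g n) S x) =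
    @cone_pt R (curve_complex R g n) (spgraph S) (pi_cone (spspin S) x)) ->
  forall (G : stable_graph g n) (Gamma : curve R G),
  exists f : set (spin G) -> Sbar R g n,
    set_bij (range (spin_orbit Gamma)) (pi @^-1` [set curve_class Gamma]) f /\
    forall (S : spin G) (Gamma' : curve R G), pi_curve Gamma' S = Gamma ->
      f (spin_orbit Gamma S) = spin_curve_class Gamma' S.
Proof.
move=> piE G Gamma; have [S0] := trivial_spin G.
(* The function must be total on sets of spin structures; on sets that are not orbits the class
   obtained from [S0] is a mere default. *)
have /choice[f fE] : forall O : set (spin G), exists p : Sbar R g n,
    forall S, O = spin_orbit Gamma S -> p = spin_curve_class (half_curve Gamma S) S.
  move=> O; have [[S ->]|nO] := pselect (exists S, O = spin_orbit Gamma S).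
    by exists (spin_curve_class (half_curve Gamma S) S) => S' /spin_orbit_eqP.
  exists (spin_curve_class (half_curve Gamma S0) S0) => S E.
  by case: nO; exists S.
have piC (G1 : stable_graph g n) (D : curve R G1) (S : spin G1) :
    pi (spin_curve_class D S) = curve_class (pi_curve D S).
  by rewrite /spin_curve_class piE /curve_class pi_curve_cone.
exists f; split; last first.
  by move=> S D E; rewrite (fE _ S) // -E pi_curveK.
split=> [_ [S _ <-] /=|O O' /set_mem[S _ <-] /set_mem[S' _ <-]|p /= pE].
- by rewrite (fE _ S) // piC half_curveK.
- by rewrite (fE _ S) // (fE _ S') // => /spin_orbit_eqP.
have [X [S [D Ep]]] := spin_positive_rep p.
move: pE; rewrite Ep piC => /curve_class_eqP[a ia].
(* The representative of p lives on another graph X; transporting S along the isometry a gives a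
   spin structure T on G whose orbit is the required preimage. *)
have [T pT] := push_exists (contr_iso a) S; have sa : spin_iso a S T by apply/spin_isoE.
exists (spin_orbit Gamma T); first by exists T.
rewrite (fE _ T) //; apply/esym/spin_class_eqP; exists a; split=> //.
by apply/(isometry_pi _ _ sa); rewrite half_curveK.
Qed.

End Fibres.

Local Open Scope classical_set_scope.
Local Open Scope ring_scope.

Theorem theoremA (R : realType) (g n : nat) (hgn : (2 < 2 * g + n)%N) :
  [/\ extended_generalized_cone_complex (spin_complex R g n) /\
      extended_generalized_cone_complex (curve_complex R g n),
      pure_dim (spin_complex R g n) (3 * g + n - 3)%N,
      ((0 < g)%N ->
         conn_components (Sbar R g n) =
           [set parity_locus R g n 0; parity_locus R g n 1] /\
         parity_locus R g n 0 <> parity_locus R g n 1) /\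
      (g = 0%N ->
         conn_components (Sbar R g n) = [set parity_locus R g n 0] /\
         parity_locus R g n 1 = set0) &
      exists pi : Sbar R g n -> Mbar R g n,
        [/\ forall (G : stable_graph g n) (Gamma : curve R G) (S : spin G),
              pi (spin_curve_class Gamma S) = curve_class (pi_curve Gamma S),
            cone_complex_morphism pi &
            forall (G : stable_graph g n) (Gamma : curve R G),
              exists f : set (spin G) -> Sbar R g n,
                set_bij (range (spin_orbit Gamma))
                        (pi @^-1` [set curve_class Gamma]) f /\
                forall (S : spin G) (Gamma' : curve R G),
                  pi_curve Gamma' S = Gamma ->
                  f (spin_orbit Gamma S) = spin_curve_class Gamma' S]].
Proof.
split.
- by split; [exact: spin_complexP | exact: curve_complexP].
- exact: pure_dim_spin.
- by split; [exact: components_pos | exact: components_zero].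
have [pi piE] := @pi_exists R g n; exists pi; split.
- move=> G Gamma S; rewrite /curve_class pi_curve_cone.
  exact: (piE (StableSpinGraph S)).
- exact: pi_morphism.
- exact: fibre_bijection.
Qed.
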